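(* Let $K$ be a field. Given arbitrary integers $r \geq 1$ and $s \geq 1$, there exist a positive integer $n \leq \max\{r, s\} + 2$ and a lexsegment ideal $I$ of the polynomial ring $S = K[x_1, \ldots, x_n]$ such that $\operatorname{reg}(S/I) = r$ and $\deg h_{S/I}(\lambda) = s$.
   Context: $S = K[x_1, \ldots, x_n]$ denotes the polynomial ring in $n$ variables over a field $K$, standard graded with $\deg x_i = 1$ for each $i$. Lexsegment ideal: a monomial ideal $I \subset S$ is a lexsegment ideal if, for all monomials $u, v \in S$ of the same degree with $u \in I$ and $v >_{\mathrm{lex}} u$, one has $v \in I$. Here $>_{\mathrm{lex}}$ is the lexicographic order induced by $x_1 > x_2 > \cdots > x_n$: for monomials of the same degree, $x_1^{a_1}\cdots x_n^{a_n} >_{\mathrm{lex}} x_1^{b_1}\cdots x_n^{b_n}$ if the leftmost nonzero entry of $(a_1 - b_1, \ldots, a_n - b_n)$ is positive. $h$-polynomial: let $I \subset S$ be a homogeneous ideal and let $d = \dim S/I$ be the Krull dimension. The Hilbert series $F(S/I, \lambda) = \sum_{m \geq 0} \dim_K (S/I)_m \, \lambda^m$ can be written as $h_{S/I}(\lambda)/(1-\lambda)^d$ with $h_{S/I}(\lambda) = h_0 + h_1\lambda + \cdots + h_t\lambda^t \in \mathbb{Z}[\lambda]$, $h_t \neq 0$. The polynomial $h_{S/I}(\lambda)$ is the $h$-polynomial of $S/I$, and $\deg h_{S/I}(\lambda) = t$ is its degree. Regularity: $\operatorname{reg}(S/I)$ denotes the Castelnuovo--Mumford regularity of $S/I$ as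 a graded $S$-module, that is, $\operatorname{reg}(S/I) = \max\{ j - i : \operatorname{Tor}_i^S(S/I, K)_j \neq 0 \}$. *)

(* Defs.v *)
From mathcomp Require Import all_boot all_order all_algebra.
From mathcomp Require Import generic_quotient ring_quotient.
From mathcomp.multinomials Require Import mpoly.

Set Implicit Arguments.
Unset Strict Implicit.
Unset Printing Implicit Defensive.

Import GRing.Theory.
Local Open Scope ring_scope.
Local Open Scope quotient_scope.

(* Ideals are terms of [idealr S], so they are proper by construction; S/I is
   the quotient ring [{ideal_quot I}] with projection [\pi].                  *)

Definition monomial_ideal (K : fieldType) (n : nat)
    (I : idealr {mpoly K[n]}) : Prop :=
  exists G : {pred 'X_{1..n}}, forall p : {mpoly K[n]},
    p \in I <->
    exists s : seq ({mpoly K[n]} * 'X_{1..n}),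
      {in s, forall t, t.2 \in G} /\ p = \sum_(t <- s) t.1 * 'X_[t.2].

(* For monomials of the same degree; index 0 of 'I_n is the largest variable. *)
Definition lex_gt (n : nat) (v u : 'X_{1..n}) : Prop :=
  exists i : 'I_n,
    (forall j : 'I_n, (j < i)%N -> v j = u j) /\ (u i < v i)%N.

Definition lexsegment_ideal (K : fieldType) (n : nat)
    (I : idealr {mpoly K[n]}) : Prop :=
  monomial_ideal I /\
  forall u v : 'X_{1..n},
    mdeg u = mdeg v -> 'X_[u] \in I -> lex_gt v u -> 'X_[v] \in I.

Definition prime_ideal (R : comNzRingType) (P : {pred R}) : Prop :=
  idealr_closed P /\ prime_idealr_closed P.

(* P 0 < P 1 < ... < P d, a chain with d strict inclusions. *)
Definition prime_chain (R : comNzRingType) (d : nat) (P : nat -> {pred R}) :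
    Prop :=
  (forall i, (i <= d)%N -> prime_ideal (P i)) /\
  (forall i, (i < d)%N ->
     {subset P i <= P i.+1} /\ ~ {subset P i.+1 <= P i}).

Definition krull_dim (R : comNzRingType) (d : nat) : Prop :=
  (exists P, prime_chain (R := R) d P) /\
  (forall e P, prime_chain (R := R) e P -> (e <= d)%N).

(* The classes of the forms e_0, ..., e_(k-1) are a K-basis of (S/I)_m. *)
Definition quotient_basis (K : fieldType) (n : nat) (I : idealr {mpoly K[n]})
    (m k : nat) (e : 'I_k -> {mpoly K[n]}) : Prop :=
  (forall i, e i \is m.-homog) /\
  (forall p : {mpoly K[n]}, p \is m.-homog ->
     exists! c : 'rV[K]_k,
       \pi_{ideal_quot I} p =
       \pi_{ideal_quot I} (\sum_(i < k) c 0 i *: e i)).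

Definition hilbert_function (K : fieldType) (n : nat)
    (I : idealr {mpoly K[n]}) (H : nat -> nat) : Prop :=
  forall m, exists e : 'I_(H m) -> {mpoly K[n]}, quotient_basis I m e.

(* The power series identity (\sum_m H(m) 'X^m) * (1 - 'X)^d = h, read
   coefficientwise.                                                           *)
Definition h_polynomial (K : fieldType) (n : nat)
    (I : idealr {mpoly K[n]}) (h : {poly int}) : Prop :=
  exists (d : nat) (H : nat -> nat),
    [/\ krull_dim {ideal_quot I} d, hilbert_function I H &
      forall k, h`_k =
        \sum_(i < k.+1) (H i)%:Z * ((1 - 'X) ^+ d : {poly int})`_(k - i)].

(* Degrees are integers, since twists may be negative; 0 has every degree. *)
Definition has_degree (K : fieldType) (n : nat) (e : int) (p : {mpoly K[n]}) :
    Prop :=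
  forall m : 'X_{1..n}, m \in msupp p -> (mdeg m)%:Z = e.

(* Free modules F_i = \bigoplus_a S(- twist i a), elements being row vectors;
   F_(i+1) -> F_i is v |-> v *m diff i and F_0 -> S/I sends the a-th basis
   vector to aug a.                                                           *)
Record augmented_free_seq (K : fieldType) (n : nat) (I : idealr {mpoly K[n]}) :=
  AugmentedFreeSeq {
    rk : nat -> nat;
    twist : forall i, 'I_(rk i) -> int;
    diff : forall i, 'M[{mpoly K[n]}]_(rk i.+1, rk i);
    aug : 'I_(rk 0) -> {ideal_quot I}
  }.

Definition aug_map (K : fieldType) (n : nat) (I : idealr {mpoly K[n]})
    (F : augmented_free_seq I) (v : 'rV[{mpoly K[n]}]_(rk F 0)) : {ideal_quot I} :=
  \sum_a \pi_{ideal_quot I} (v 0 a) * aug a.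

Definition graded_free_resolution (K : fieldType) (n : nat)
    (I : idealr {mpoly K[n]}) (F : augmented_free_seq I) : Prop :=
  (* the maps are homogeneous of degree 0 *)
  (forall a : 'I_(rk F 0), exists p : {mpoly K[n]},
     has_degree (twist a) p /\ aug a = \pi_{ideal_quot I} p) /\
  (forall i (a : 'I_(rk F i.+1)) (b : 'I_(rk F i)),
     has_degree (twist a - twist b) (diff F i a b)) /\
  (* ... -> F_1 -> F_0 -> S/I -> 0 is exact *)
  (forall x : {ideal_quot I}, exists v, aug_map (F := F) v = x) /\
  (forall v : 'rV_(rk F 0),
     aug_map (F := F) v = 0 <-> exists w, v = w *m diff F 0) /\
  (forall i (v : 'rV_(rk F i.+1)),
     v *m diff F i = 0 <-> exists w, v = w *m diff F i.+1).

(* Evaluation at the origin is the projection S -> S/(x_1, ..., x_n) = K, so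
   these are the matrices of the complex of K-vector spaces F \otimes_S K.    *)
Definition tensorK_diff (K : fieldType) (n : nat) (I : idealr {mpoly K[n]})
    (F : augmented_free_seq I) (i : nat) : 'M[K]_(rk F i.+1, rk F i) :=
  map_mx (fun p : {mpoly K[n]} => p.@[fun=> 0]) (diff F i).

Definition in_degree (K : fieldType) (n : nat) (I : idealr {mpoly K[n]})
    (F : augmented_free_seq I) (i : nat) (j : int) (v : 'rV[K]_(rk F i)) : Prop :=
  forall a, v 0 a != 0 -> twist a = j.

Definition tensorK_cycle (K : fieldType) (n : nat) (I : idealr {mpoly K[n]})
    (F : augmented_free_seq I) (i : nat) : 'rV[K]_(rk F i) -> Prop :=
  match i return 'rV[K]_(rk F i) -> Prop with
  | 0 => fun _ => True
  | i'.+1 => fun v => v *m tensorK_diff F i' = 0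
  end.

(* Tor_i(S/I, K)_j != 0, computed as H_i(F \otimes_S K)_j. *)
Definition Tor_neq0 (K : fieldType) (n : nat) (I : idealr {mpoly K[n]})
    (F : augmented_free_seq I) (i : nat) (j : int) : Prop :=
  exists v : 'rV[K]_(rk F i),
    [/\ in_degree j v, tensorK_cycle v &
      ~ exists w : 'rV[K]_(rk F i.+1),
          in_degree j w /\ v = w *m tensorK_diff F i].

(* Tor, hence the maximum, does not depend on the resolution F of S/I. *)
Definition regularity (K : fieldType) (n : nat) (I : idealr {mpoly K[n]})
    (r : int) : Prop :=
  exists F : augmented_free_seq I,
    [/\ graded_free_resolution F,
      exists (i : nat) (j : int), Tor_neq0 F i j /\ j - i%:Z = r &
      forall (i : nat) (j : int), Tor_neq0 F i j -> j - i%:Z <= r].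

(* Main.v *)
(** Both cases use a lexsegment ideal spanned by an explicit set of monomials.

    If s <= r, take n = r + 2 and the ideal whose degree d part is zero for
    d < s and omits exactly the r + 1 lexicographically smallest monomials for
    d >= s.  Its quotient has dimension 1 and Hilbert function constant from
    degree s on, with a jump at s, so deg h = s; the power of degree r + 1 of
    the last but one variable is a minimal generator of largest degree.

    If s > r, take n = s - r + 1 and the ideal x_1^r (x_1, ..., x_n), for which
    h = 1 + ... + t^(r-1) + t^r (1 - t)^(n-1).

    The regularity of a lexsegment ideal is read off its generators: adding
    them one at a time, by increasing degree and from the lexicographically
    largest down, each colon ideal is generated by an initial segment of the
    variables, so iterated mapping cones give a resolution with the right
    twists, and a minimal generator of largest degree survives in Tor_1.

    The Krull dimension is bounded above by counting: elements separating the
    terms of a chain of primes are algebraically independent, which forces the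
    Hilbert function to grow. *)

Require Import Defs.
From HB Require Import structures.
From mathcomp Require Import all_boot all_order all_algebra.
From mathcomp Require Import generic_quotient ring_quotient.
From mathcomp.multinomials Require Import mpoly.
From mathcomp Require Import zify.
From Stdlib Require Import ClassicalEpsilon.

Set Implicit Arguments.
Unset Strict Implicit.
Unset Printing Implicit Defensive.

Import Order.TTheory GRing.Theory Num.Theory.
Local Open Scope ring_scope.
Local Open Scope quotient_scope.

(** * Homogeneous components and monomial subspaces *)

Section HomogeneousComponents.
Variables (K : fieldType) (n : nat).
Implicit Types (p q : {mpoly K[n]}) (e : int) (m : 'X_{1..n}).

Lemma has_degreeP e p :
  has_degree e p <-> forall m, (mdeg m)%:Z != e -> p@_m = 0.
Proof.
split=> [hp m|hp m].
  by apply: contraNeq; rewrite -mcoeff_msupp => /hp ->.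
by rewrite mcoeff_msupp => /eqP; case: ((mdeg m)%:Z =P e) => // /eqP /hp.
Qed.

Lemma has_degree0 e : has_degree e (0 : {mpoly K[n]}).
Proof. by move=> m; rewrite msupp0. Qed.

Lemma has_degreeN e p : has_degree e p -> has_degree e (- p).
Proof.
by move=> /has_degreeP hp; apply/has_degreeP => m /hp; rewrite mcoeffN => ->; rewrite oppr0.
Qed.

Lemma has_degreeX m : has_degree (mdeg m)%:Z ('X_[m] : {mpoly K[n]}).
Proof. by move=> k /mem_msuppXP ->. Qed.

Lemma has_degreeM e1 e2 p q :
  has_degree e1 p -> has_degree e2 q -> has_degree (e1 + e2) (p * q).
Proof.
move=> hp hq m /msuppM_le /allpairsP [[m1 m2] /= [h1 h2 ->]].
by rewrite mdegD PoszD (hp _ h1) (hq _ h2).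
Qed.

Definition homog_comp e p : {mpoly K[n]} :=
  \sum_(m <- msupp p | (mdeg m)%:Z == e) p@_m *: 'X_[m].

Lemma mcoeff_homog_comp e p m :
  (homog_comp e p)@_m = if (mdeg m)%:Z == e then p@_m else 0.
Proof.
rewrite /homog_comp raddf_sum /=.
transitivity (\sum_(k <- msupp p | k == m) (if (mdeg m)%:Z == e then p@_m else 0)).
  rewrite [RHS]big_mkcond [LHS]big_mkcond /=; apply: eq_bigr => k _.
  rewrite mcoeffZ mcoeffX; case: (eqVneq k m) => [->|ne]; first by rewrite mulr1.
  by rewrite mulr0 if_same.
have [hm|hm] := boolP (m \in msupp p).
  by rewrite -big_filter filter_pred1_uniq ?msupp_uniq // big_seq1.
by rewrite (memN_msupp_eq0 hm) if_same big1.
Qed.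

Lemma has_degree_homog_comp e p : has_degree e (homog_comp e p).
Proof. by apply/has_degreeP => m /negPf h; rewrite mcoeff_homog_comp h. Qed.

Lemma homog_comp_id e p : has_degree e p -> homog_comp e p = p.
Proof.
move=> /has_degreeP hp; apply/mpolyP => m; rewrite mcoeff_homog_comp.
by case: eqP => // /eqP /hp ->.
Qed.

Lemma homog_comp_sum e (I : Type) (s : seq I) (F : I -> {mpoly K[n]}) :
  homog_comp e (\sum_(i <- s) F i) = \sum_(i <- s) homog_comp e (F i).
Proof.
apply/mpolyP => m; rewrite mcoeff_homog_comp; case: ifP => h; rewrite !raddf_sum.
  by apply: eq_bigr => i _; rewrite [RHS]mcoeff_homog_comp h.
by rewrite big1 // => i _; rewrite [LHS]mcoeff_homog_comp h.
Qed.

Lemma homog_compM e e' p q : has_degree e' q ->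
  homog_comp (e + e') (p * q) = homog_comp e p * q.
Proof.
move=> /has_degreeP hq; apply/mpolyP => m; rewrite mcoeff_homog_comp !mcoeffM.
transitivity (\sum_(k : 'X_{1..n < (mdeg m).+1, (mdeg m).+1} | m == (k.1 + k.2)%MM)
  (if (mdeg m)%:Z == e + e' then p@_k.1 * q@_k.2 else 0)).
  by case: ifP => // _; rewrite big1.
apply: eq_bigr => k /eqP /(congr1 (@mdeg n)) hm; rewrite mcoeff_homog_comp.
rewrite mdegD in hm; rewrite [X in Posz X == _]hm PoszD.
have [hk|/hq->] := eqVneq (mdeg k.2)%:Z e'; last by rewrite !mulr0 if_same.
by rewrite hk (inj_eq (addIr _)); case: ifP => //; rewrite mul0r.
Qed.

Definition homog_mx a b (s : 'I_a -> int) (t : 'I_b -> int) (A : 'M[{mpoly K[n]}]_(a, b)) :=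
  forall i j, has_degree (s i - t j) (A i j).

(** Replacing each coefficient of [w] by its component of the degree prescribed by the twists does
    not disturb the product, since [X] and [D] are already homogeneous. This makes lifts through
    exact sequences homogeneous of degree 0. *)
Lemma homog_factor a b c (s : 'I_a -> int) (t : 'I_b -> int) (u : 'I_c -> int)
    (X : 'M[{mpoly K[n]}]_(a, c)) (D : 'M_(b, c)) :
  homog_mx s u X -> homog_mx t u D ->
  (forall i, exists w, row i X = w *m D) ->
  exists W, homog_mx s t W /\ X = W *m D.
Proof.
move=> hX hD /fin_all_exists [w hw].
exists (\matrix_(i, j) homog_comp (s i - t j) (w i 0 j)); split.
  by move=> i j; rewrite mxE; apply: has_degree_homog_comp.
apply/matrixP => i k; rewrite !mxE -(homog_comp_id (hX i k)).
have -> : X i k = \sum_j w i 0 j * D j k.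
  by have /rowP/(_ k) := hw i; rewrite !mxE.
rewrite homog_comp_sum; apply: eq_bigr => j _; rewrite mxE.
by rewrite -(homog_compM _ _ (hD j k)) addrA subrK.
Qed.

End HomogeneousComponents.

(** Dependent choice along a family of types: the lifts forming a comparison map are matrices whose
    sizes vary with the homological degree. *)
Lemma dependent_sequence (T : nat -> Type) (P : forall i, T i -> Prop)
    (R : forall i, T i -> T i.+1 -> Prop) (x0 : T 0) :
  P 0 x0 -> (forall i x, P i x -> exists y, P i.+1 y /\ R i x y) ->
  exists f : forall i, T i, [/\ f 0 = x0, forall i, P i (f i) & forall i, R i (f i) (f i.+1)].
Proof.
move=> P0 step.
pose next i (x : {x | P i x}) : {x | P i.+1 x} :=
  let: exist y hy := constructive_indefinite_description _ (step i _ (proj2_sig x)) in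
  exist _ y (proj1 hy).
pose fix f i : {x | P i x} :=
  match i with 0 => exist _ x0 P0 | i.+1 => next i (f i) end.
exists (fun i => proj1_sig (f i)); split=> [//|i|i]; first exact: proj2_sig.
rewrite /= /next.
by case: constructive_indefinite_description => y [].
Qed.

Section MonomialSubspace.
Variables (K : fieldType) (n : nat).
Implicit Types (M : pred 'X_{1..n}) (p q : {mpoly K[n]}) (u m : 'X_{1..n}).

Definition mono_in M p := all M (msupp p).

Lemma mono_inP M p : reflect (forall m, ~~ M m -> p@_m = 0) (mono_in M p).
Proof.
apply: (iffP allP) => h m; last first.
  by rewrite mcoeff_msupp; apply: contraNT => /h ->.
by apply: contraNeq; rewrite -mcoeff_msupp => /h.
Qed.

Lemma eq_mono_in M M' p : M =1 M' -> mono_in M p = mono_in M' p.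
Proof. by move=> h; apply: eq_all. Qed.

Definition colon M u : pred 'X_{1..n} := fun w => M (w + u)%MM.
Definition adjoin M u : pred 'X_{1..n} := fun w => M w || (u <= w)%MM.

Lemma mono_in_colon M u p : mono_in M (p * 'X_[u]) = mono_in (colon M u) p.
Proof.
rewrite /mono_in (perm_all _ (msuppMX p u)) all_map.
by apply: eq_all => w /=; rewrite /colon addmC.
Qed.

Lemma mcoeffMX_sub p u m :
  (p * 'X_[u])@_m = if (u <= m)%MM then p@_(m - u) else 0.
Proof.
case: ifP => [h|h]; first by rewrite -{1}(submK h) addmC mcoeffMX.
apply/eqP; rewrite mcoeff_eq0; apply/negP.
rewrite (perm_mem (msuppMX p u)) => /mapP [w _ hm].
by move: h; rewrite hm lem_addr.
Qed.

Lemma mono_in_adjoin M u p : mono_in (adjoin M u) p <->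
  exists a b, mono_in M a /\ p = a + b * 'X_[u].
Proof.
split=> [/mono_inP hp|[a [b [/mono_inP ha ->]]]]; last first.
  apply/mono_inP => m; rewrite negb_or => /andP[/ha hm /negPf hu].
  by rewrite mcoeffD hm mcoeffMX_sub hu add0r.
(* The terms of [p] outside [M] are all divisible by [u]; [b] is their sum divided by [u]. *)
pose b : {mpoly K[n]} := \sum_(m <- msupp p | ~~ M m && (u <= m)%MM) p@_m *: 'X_[m - u].
have hb m : (b * 'X_[u])@_m = if ~~ M m then p@_m else 0.
  rewrite /b mulr_suml raddf_sum /=.
  transitivity (\sum_(k <- msupp p | k == m) (if ~~ M m then p@_m else 0)).
    rewrite [LHS]big_mkcond [RHS]big_mkcond /=; apply: eq_big_seq => k hk.
    case: ifP => [/andP[hMk huk]|].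
      rewrite -scalerAl -mpolyXD submK // mcoeffZ mcoeffX.
      by case: (eqVneq k m) => [<-|ne]; rewrite ?hMk ?eqxx ?mulr1 ?mulr0.
    move/negbT; rewrite negb_and negbK; case: eqVneq => // -> /orP[->|hu] //.
    case: ifP => // hM; rewrite hp //.
    by rewrite /adjoin negb_or hM.
  have [hm|hm] := boolP (m \in msupp p).
    by rewrite -big_filter filter_pred1_uniq ?msupp_uniq // big_seq1.
  by rewrite (memN_msupp_eq0 hm) if_same big1.
exists (p - b * 'X_[u]), b; split; last by rewrite subrK.
by apply/mono_inP => m hm; rewrite mcoeffB hb hm subrr.
Qed.

End MonomialSubspace.

(** * Mapping cones *)

Section ExactMatrices.
Variable R : comNzRingType.

Definition exact_at a b c (B : 'M[R]_(a, b)) (A : 'M[R]_(b, c)) :=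
  forall v : 'rV_b, v *m A = 0 <-> exists w, v = w *m B.

Lemma exact_mul0 a b c (B : 'M[R]_(a, b)) (A : 'M[R]_(b, c)) :
  exact_at B A -> B *m A = 0.
Proof.
move=> ex; apply/row_matrixP => i; rewrite row_mul row0; apply/ex.
by exists (delta_mx 0 i); rewrite rowE.
Qed.

(** In a cycle [(x, y)] the part [y] is a boundary [c *m B1]. Correcting [x] by [c *m P1] gives a
    cycle of [A0], hence some [w *m A1], and [(w, - c)] maps to [(x, y)]. *)
Lemma cone_exact a2 a1 a0 b2 b1 b0 (A1 : 'M[R]_(a2, a1)) (A0 : 'M_(a1, a0))
    (B1 : 'M_(b2, b1)) (B0 : 'M_(b1, b0)) (P1 : 'M_(b2, a1)) (P0 : 'M_(b1, a0)) :
  exact_at A1 A0 -> exact_at B1 B0 -> P1 *m A0 = B1 *m P0 ->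
  exact_at (block_mx A1 0 P1 (- B1)) (block_mx A0 0 P0 (- B0)).
Proof.
move=> exA exB hP v; rewrite -[v]hsubmxK; set x := lsubmx v; set y := rsubmx v.
split.
  rewrite mul_row_block mulmx0 add0r mulmxN -[0]row_mx0 => /eq_row_mx [hx hy].
  have /exB [c hc] : y *m B0 = 0 by apply/eqP; rewrite -oppr_eq0 hy.
  have /exA [w hw] : (x + c *m P1) *m A0 = 0.
    by rewrite mulmxDl -mulmxA hP mulmxA -hc.
  exists (row_mx w (- c)).
  by rewrite mul_row_block mulmx0 add0r mulmxN !mulNmx opprK -hw addrK hc.
case=> w ->; rewrite -[w]hsubmxK -mulmxA mulmx_block.
rewrite !mul0mx !mulmx0 mulNmx hP (exact_mul0 exA) mulNmx mulmxN opprK (exact_mul0 exB).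
by rewrite !addr0 addrN block_mx0 mulmx0.
Qed.

(* The base of the cone: multiplication by [u] maps the module generated by
   [B0] isomorphically onto the part of [u R] lying in the one generated by
   [A0]. *)
Lemma cone_exact_base a2 a1 b1 (A1 : 'M[R]_(a2, a1)) (A0 : 'cV_a1)
    (B0 : 'cV_b1) (P0 : 'M_(b1, a1)) u :
  exact_at A1 A0 -> P0 *m A0 = B0 *m u%:M ->
  (forall (x : 'rV_a1) (y : 'rV_1), x *m A0 + y *m u%:M = 0 -> exists c, y = c *m B0) ->
  exact_at (block_mx A1 0 P0 (- B0)) (col_mx A0 u%:M).
Proof.
move=> exA hP hu v; rewrite -[v]hsubmxK; set x := lsubmx v; set y := rsubmx v.
split.
  rewrite mul_row_col => hxy; have [c hc] := hu _ _ hxy.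
  have /exA [w hw] : (x + c *m P0) *m A0 = 0.
    by rewrite mulmxDl -mulmxA hP mulmxA -hc.
  exists (row_mx w (- c)).
  by rewrite mul_row_block mulmx0 add0r mulmxN !mulNmx opprK -hw addrK hc.
case=> w ->; rewrite -mulmxA mul_block_col !mul0mx hP (exact_mul0 exA).
by rewrite mulNmx addrN addr0 col_mx0 mulmx0.
Qed.

End ExactMatrices.

Section MappingCone.
Variables (K : fieldType) (n : nat).
Local Notation S := {mpoly K[n]}.
Implicit Types (M : pred 'X_{1..n}) (u m : 'X_{1..n}).

(* A complex ... -> F_1 -> F_0 -> S resolving an ideal rather than its
   quotient ring, so that [fgen] lists generators of the ideal. *)
Record free_seq := FreeSeq {
  frk : nat -> nat;
  ftw : forall i, 'I_(frk i) -> nat;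
  fgen : 'cV[S]_(frk 0);
  fdif : forall i, 'M[S]_(frk i.+1, frk i)
}.

Definition ftwz (F : free_seq) i (a : 'I_(frk F i)) : int := (ftw a)%:Z.

(* [D] bounds the regularity of the ideal spanned by the monomials in [M]. *)
Record resolves M (D : nat) (F : free_seq) : Prop := Resolves {
  res_gen_homog : forall a, has_degree (ftwz a) (fgen F a 0);
  res_dif_homog : forall i, homog_mx (@ftwz F i.+1) (@ftwz F i) (fdif F i);
  res_image : forall p : S, mono_in M p <-> exists v, p%:M = v *m fgen F;
  res_exact0 : exact_at (fdif F 0) (fgen F);
  res_exact : forall i, exact_at (fdif F i.+1) (fdif F i);
  res_bound : forall i (a : 'I_(frk F i)), (ftw a <= i + D)%N
}.

Arguments res_dif_homog [M D F] _ i a b : rename.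
Arguments res_exact [M D F] _ i v : rename.

Lemma eq_resolves M M' D F : M =1 M' -> resolves M D F -> resolves M' D F.
Proof.
by move=> eqM [*]; split=> // p; rewrite -(eq_mono_in _ eqM).
Qed.

Lemma resolves_empty D : exists F, resolves xpred0 D F.
Proof.
exists (@FreeSeq (fun _ => 0%N) (fun _ _ => 0%N) 0 (fun _ => 0)); split.
- by case.
- by move=> i [].
- move=> p; split=> [/mono_inP hp|[v /matrixP/(_ 0 0)]].
    by exists 0; rewrite mul0mx (_ : p = 0) ?raddf0 //; apply/mpolyP => m; rewrite hp ?mcoeff0.
  by rewrite !mxE big_ord0 mulr1n => ->; rewrite /mono_in msupp0.
- by move=> v; split=> _; [exists 0; apply/rowP => [[]] | rewrite mulmx0].
- by move=> i v; split=> _; [exists 0; apply/rowP => [[]] | rewrite mulmx0].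
- by move=> i [].
Qed.

Section Cone.
Variables (F G : free_seq) (u : 'X_{1..n}).
Variable phi : forall i, 'M[S]_(frk G i, frk F i).

(** The mapping cone of [phi], from [G] shifted by the degree of [u] to [F]. As ideals are resolved,
    the target of [fgen G] becomes the new generator [u] in degree 0, and degree [j] of [G] moves to
    degree [j.+1]. *)
Definition cone_rk i := match i with 0 => frk F 0 + 1 | j.+1 => frk F j.+1 + frk G j end%N.

Definition cone_tw i : 'I_(cone_rk i) -> nat :=
  match i with
  | 0 => fun a => match split a with inl x => ftw x | inr _ => mdeg u end
  | j.+1 => fun a => match split a with inl x => ftw x | inr y => ftw y + mdeg u end
  end%N.

Definition cone_dif i : 'M[S]_(cone_rk i.+1, cone_rk i) :=
  match i with
  | 0 => block_mx (fdif F 0) 0 (phi 0) (- fgen G)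
  | j.+1 => block_mx (fdif F j.+1) 0 (phi j.+1) (- fdif G j)
  end.

Definition cone := FreeSeq cone_tw (col_mx (fgen F) ('X_[u])%:M : 'cV_(cone_rk 0)) cone_dif.

End Cone.

Definition twz_shift (F : free_seq) (k : nat) i (a : 'I_(frk F i)) : int := (ftw a + k)%:Z.

(** Multiplication by [u] sends the ideal of [colon M u] into that of [M]; exactness of [F] lifts it
    degree by degree to a homogeneous chain map. *)
Lemma comparison_map F G M u D D' :
  resolves M D F -> resolves (colon M u) D' G ->
  exists phi : forall i, 'M[S]_(frk G i, frk F i),
  [/\ forall i, homog_mx (@twz_shift G (mdeg u) i) (@ftwz F i) (phi i),
      phi 0 *m fgen F = fgen G *m ('X_[u])%:M &
      forall i, phi i.+1 *m fdif F i = fdif G i *m phi i].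
Proof.
move=> rF rG.
(* The invariant of the recursion: the next differential of [G] followed by the current lift is
   killed in [F], so it can be lifted again. *)
pose killed i : 'M[S]_(frk G i, frk F i) -> Prop :=
  match i with
  | 0 => fun f => fdif G 0 *m f *m fgen F = 0
  | j.+1 => fun f => fdif G j.+1 *m f *m fdif F j = 0
  end.
pose P i f := homog_mx (@twz_shift G (mdeg u) i) (@ftwz F i) f /\ killed i f.
have [phi0 [h0 e0]] : exists phi0, homog_mx (@twz_shift G (mdeg u) 0) (@ftwz F 0) phi0 /\
    fgen G *m ('X_[u])%:M = phi0 *m fgen F.
  apply: (@homog_factor _ _ _ _ _ _ _ (fun _ : 'I_1 => 0)).
  - move=> a b; rewrite (ord1 b) subr0 mul_mx_scalar mxE mulrC /twz_shift PoszD.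
    by apply: has_degreeM; [exact: (res_gen_homog rG) | exact: has_degreeX].
  - by move=> a b; rewrite (ord1 b) subr0; apply: (res_gen_homog rF).
  - move=> a; have : mono_in M (fgen G a 0 * 'X_[u]).
      rewrite mono_in_colon; apply/(res_image rG); exists (delta_mx 0 a).
      by rewrite -rowE; apply/matrixP => i j; rewrite !ord1 !mxE mulr1n.
    case/(res_image rF) => w hw; exists w; rewrite -hw.
    by apply/matrixP => i j; rewrite !ord1 mul_mx_scalar !mxE mulr1n mulrC.
have P0 : P 0 phi0.
  by split=> //=; rewrite -mulmxA -e0 mulmxA (exact_mul0 (res_exact0 rG)) mul0mx.
have step i f : P i f -> exists g, P i.+1 g /\ fdif G i *m f = g *m fdif F i.
  case=> hf kf.
  have [g [hg eg]] : exists g, homog_mx (@twz_shift G (mdeg u) i.+1) (@ftwz F i.+1) g /\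
      fdif G i *m f = g *m fdif F i.
    apply: (@homog_factor _ _ _ _ _ _ _ (@ftwz F i)).
    - move=> a b; rewrite mxE.
      apply/has_degreeP => m hm; rewrite raddf_sum big1 //= => c _.
      have hd := has_degreeM (res_dif_homog rG i a c) (hf c b); move/has_degreeP: hd; apply.
      apply: contraNneq hm => ->; rewrite /twz_shift /ftwz !PoszD.
      by rewrite -(addrA _ _ (- _)) subrKA addrA.
    - exact: (res_dif_homog rF).
    - case: i f {hf} kf => [|i] f kf a.
        by apply/(res_exact0 rF); rewrite -row_mul kf row0.
      by apply/(res_exact rF); rewrite -row_mul kf row0.
  exists g; split=> //; split=> //=.
  by rewrite -mulmxA -eg mulmxA (exact_mul0 (res_exact rG i)) mul0mx.
have [phi [hphi0 hP hR]] := dependent_sequence P0 step.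
by exists phi; split=> [i||i]; [case: (hP i) | rewrite hphi0 | rewrite hR].
Qed.

(** A summand of [G] in degree i has twist at most [i + D']; in the cone it sits in degree i + 1
    with twist raised by [mdeg u], whence the second inequality. The first one serves the new
    generator. *)
Lemma resolves_cone M u D D' F G :
  resolves M D F -> resolves (colon M u) D' G ->
  (mdeg u <= D)%N -> (mdeg u + D' <= D.+1)%N ->
  exists H, resolves (adjoin M u) D H.
Proof.
move=> rF rG leu leD; have [phi [hphi phi0 phiS]] := comparison_map rF rG.
exists (cone u phi); split.
- move=> a; rewrite /ftwz /= mxE /=.
  case: splitP => b _; first exact: (res_gen_homog rF).
  by rewrite !ord1 mxE mulr1n; apply: has_degreeX.
- have zero (e : int) a b (i : 'I_a) (j : 'I_b) : has_degree e ((0 : 'M[S]_(a, b)) i j).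
    by rewrite mxE; apply: has_degree0.
  case=> [|i] a b; rewrite /ftwz /= [X in has_degree _ X]mxE.
    case: (split a) => x; rewrite mxE; case: (split b) => y //=.
    + exact: (res_dif_homog rF).
    + exact: hphi.
    + by rewrite mxE; apply: has_degreeN; rewrite (ord1 y) PoszD addrK; apply: (res_gen_homog rG).
  case: (split a) => x; rewrite mxE; case: (split b) => y //=.
  + exact: (res_dif_homog rF).
  + exact: hphi.
  + rewrite mxE; apply: has_degreeN; rewrite !PoszD opprD addrACA subrr addr0.
    exact: (res_dif_homog rG).
- move=> p; rewrite mono_in_adjoin; split.
    case=> a [b [/(res_image rF) [v hv] ->]]; exists (row_mx v b%:M).
    by rewrite mul_row_col -hv -scalar_mxM raddfD.
  case=> v hv; rewrite -[v]hsubmxK mul_row_col in hv.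
  exists ((lsubmx v *m fgen F) 0 0), (rsubmx v 0 0); split.
    by apply/(res_image rF); exists (lsubmx v); rewrite -mx11_scalar.
  have /matrixP/(_ 0 0) := hv; rewrite mxE mulr1n => ->.
  by rewrite mxE mul_mx_scalar; congr (_ + _); rewrite mxE mulrC.
- apply: cone_exact_base => //; first exact: (res_exact0 rF).
  move=> x y hxy; have : mono_in (colon M u) (y 0 0).
    rewrite -mono_in_colon; apply/(res_image rF); exists (- x).
    rewrite mulNmx (addr0_eq hxy) scalar_mxM; congr (_ *m _).
    by rewrite -mx11_scalar.
  by case/(res_image rG) => c hc; exists c; rewrite -hc -mx11_scalar.
- case=> [|i]; apply: cone_exact => //.
  + exact: (res_exact rF).
  + exact: (res_exact0 rG).
  + exact: (res_exact rF).
  + exact: (res_exact rG).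
- case=> [|i] a /=; case: (split a) => x; rewrite ?add0n ?(res_bound rF) //.
  rewrite (leq_trans (leq_add (res_bound rG x) (leqnn _))) // addSnnS -addnA leq_add2l.
  by rewrite addnC.
Qed.

End MappingCone.

(** * Resolutions of lexsegment ideals *)

Section LexsegmentResolution.
Variables (K : fieldType) (n : nat).
Implicit Types (M : pred 'X_{1..n}) (u t w m : 'X_{1..n}) (T : seq 'X_{1..n}).

Definition vars_below k : pred 'X_{1..n} :=
  fun w => [exists i : 'I_n, (i < k)%N && (w i != 0%N)].

(** The Koszul complex, built by cones: the next variable is a nonzerodivisor modulo the previous
    ones, so the colon ideal is the ideal itself and [F] is joined to its own shift. *)
Lemma resolves_vars_below k : (k <= n)%N ->
  exists F : free_seq K n, resolves (vars_below k) 1 F.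
Proof.
elim: k => [_|k IHk lt_kn].
  have [F rF] := resolves_empty K n 1; exists F; apply: eq_resolves rF => w.
  by apply/esym/existsP => -[].
have [F rF] := IHk (ltnW lt_kn); pose u : 'X_{1..n} := U_(Ordinal lt_kn)%MM.
have colonE : colon (vars_below k) u =1 vars_below k.
  move=> w; apply: eq_existsb => i; rewrite mnmDE mnm1E.
  by case: ltngtP => //= ik; rewrite -val_eqE /= (gtn_eqF ik) addn0.
have := resolves_cone (u := u) rF (eq_resolves (fsym colonE) rF).
rewrite mdeg1 => /(_ isT isT) [H rH]; exists H; apply: eq_resolves rH => w.
rewrite /adjoin /u lep1mP; apply/orP/existsP => [[/existsP [i /andP[ik wi]]|wk]|].
- by exists i; rewrite ltnS ltnW.
- by exists (Ordinal lt_kn); rewrite /= ltnSn.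
- case=> i /andP[]; rewrite ltnS leq_eqVlt => /orP[/eqP ik wi|ik wi].
    by right; rewrite (_ : Ordinal _ = i) //; apply: val_inj.
  by left; apply/existsP; exists i; rewrite ik.
Qed.

Definition up_closed M := forall u w, M u -> (u <= w)%MM -> M w.
(** Between monomials of equal degree, the order [<] is the lexicographic one with index 0 the
    largest variable. *)
Definition lex_closed M := forall u v, mdeg u = mdeg v -> M u -> (u < v)%O -> M v.

Definition up T : pred 'X_{1..n} := fun w => has (fun t => (t <= w)%MM) T.

(** The monomial [t x_i / x_j]; exponents are subtracted with truncation, so this reading requires
    [x_j] to divide [t]. *)
Definition exchange t (i j : 'I_n) := (t + U_(i) - U_(j))%MM.

Lemma exchangeE t (i j k : 'I_n) : i != j -> t j != 0%N ->
  exchange t i j k = if k == i then (t i).+1 else if k == j then (t j).-1 else t k.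
Proof.
move=> ij tj; rewrite mnmBE mnmDE !mnm1E ![_ == k]eq_sym.
case: (eqVneq k i) => [->|ki]; first by rewrite (negPf ij) subn0 addn1.
by case: (eqVneq k j) => [->|kj]; rewrite addn0 ?subn1 ?subn0.
Qed.

Lemma mdeg_exchange t (i j : 'I_n) : t j != 0%N -> mdeg (exchange t i j) = mdeg t.
Proof.
move=> tj; apply/eqP; rewrite -(eqn_add2r 1) -{1}(mdeg1 j) -mdegD submK ?mdegD ?mdeg1 //.
by apply: lepm_trans (lem_addr _ _); rewrite lep1mP.
Qed.

Lemma ltmc_exchange t (i j : 'I_n) : (i < j)%N -> t j != 0%N -> (t < exchange t i j)%O.
Proof.
move=> ij tj; have nij : i != j by apply: contraTneq ij => ->; rewrite ltnn.
apply/ltmcP; first by rewrite mdeg_exchange.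
exists i => [k ki|]; rewrite exchangeE // ?eqxx //.
by rewrite -!val_eqE /= (ltn_eqF ki) (ltn_eqF (ltn_trans ki ij)).
Qed.

(* By increasing degree, and from the lexicographically largest down. *)
Definition before t u := (mdeg t < mdeg u)%N || (mdeg t == mdeg u) && (u < t)%O.
Definition before_eq t u := (t == u) || before t u.

Lemma before_eq_total : total before_eq.
Proof.
move=> t u; rewrite /before_eq /before (eq_sym u) (eq_sym (mdeg u)).
case: (ltngtP (mdeg t) (mdeg u)) => _; rewrite ?orbT //=.
by case: ltgtP; rewrite ?orbT.
Qed.

Lemma before_trans : transitive before.
Proof.
move=> u t w /orP[h1|/andP[/eqP h1 g1]] /orP[h2|/andP[/eqP h2 g2]].
- by rewrite /before (ltn_trans h1 h2).
- by rewrite /before -h2 h1.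
- by rewrite /before h1 h2.
- by rewrite /before h1 h2 eqxx (lt_trans g2 g1) orbT.
Qed.

Lemma before_eq_trans : transitive before_eq.
Proof.
move=> u t w /orP[/eqP->//|h1] /orP[/eqP<-|h2]; first by rewrite /before_eq h1 orbT.
by rewrite /before_eq (before_trans h1 h2) orbT.
Qed.

Lemma before_irr t : before t t = false.
Proof. by rewrite /before ltnn ltxx andbF. Qed.

Lemma leq_mdeg_before t u : before t u -> (mdeg t <= mdeg u)%N.
Proof. by case/orP => [/ltnW//|/andP[/eqP->]]. Qed.

(* Exchanging variables of [t] exceeding [u] for larger ones that [t] still
   lacks eventually produces a divisor of [u]. *)
Lemma divisor_before M u w t : lex_closed M ->
  (forall i j : 'I_n, (i < j)%N -> w i != 0%N -> u j = 0%N) ->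
  M t -> before t u -> (t <= w + u)%MM ->
  exists t', [/\ M t', before t' u & (t' <= u)%MM].
Proof.
move=> lexM hw; have [k] := ubnP (mdeg (t - u)).
elim: k t => // k IHk t le_k Mt tu ltw.
have [/forallP ltu|/forallPn [j]] := boolP [forall i, (t i <= u i)%N].
  by exists t; split=> //; apply/mnm_lepP.
rewrite -ltnNge => utj.
(* The degree of [t] is at most that of [u], so exceeding [u] at [j] forces [t] to fall short of it
   at some [i]. *)
have [/forallP ut|/forallPn [i]] := boolP [forall i, (u i <= t i)%N].
  have := leq_mdeg_before tu; rewrite leqNgt => /negP [].
  by rewrite !mdegE (bigD1 j) //= [X in (_ < X)%N](bigD1 j) //= -addSn leq_add // leq_sum.
rewrite -ltnNge => tui.
have nij : i != j by apply: contraTneq tui => ->; rewrite -leqNgt ltnW.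
have wj : w j != 0%N.
  apply: contraTneq utj => w0; rewrite -leqNgt.
  by move/mnm_lepP/(_ j): ltw; rewrite mnmDE w0.
(* Since [w j] is nonzero, [u] vanishes after [j]; as [u i] is positive, [i] comes before [j]. *)
have ij : (i < j)%N.
  rewrite ltn_neqAle nij leqNgt; apply/negP => ji.
  by move: tui; rewrite (hw j i).
have tj : t j != 0%N by rewrite -lt0n (leq_trans _ utj).
apply: (IHk (exchange t i j)).
(* The exchange lowers the degree of [t - u], the measure of the induction, by one. *)
- rewrite -ltnS (leq_trans _ le_k) // ltnS -addn1 -(mdeg1 j) -mdegD.
  apply/eq_leq; congr mdeg; apply/mnmP => l; rewrite mnmDE mnmBE exchangeE // mnmBE mnm1E.
  case: (eqVneq l i) => [->|li].
    move: tui (ltnW tui); rewrite -!subn_eq0 => /eqP -> /eqP ->.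
    by rewrite eq_sym (negPf nij).
  rewrite eq_sym; case: (eqVneq l j) => [->|lj]; rewrite ?addn0 // addn1 -subn1 subnAC subn1.
  by rewrite prednK // subn_gt0.
- by apply: lexM Mt (ltmc_exchange ij tj); rewrite mdeg_exchange.
- rewrite /before mdeg_exchange //; case/orP: tu => [->//|/andP[-> ut]].
  by rewrite (lt_trans ut (ltmc_exchange ij tj)) orbT.
- apply/mnm_lepP => l; rewrite exchangeE // mnmDE; have := mnm_lepP ltw l; rewrite mnmDE.
  case: (eqVneq l i) => [->|li]; first by rewrite (leq_trans tui) // leq_addl.
  by case: (eqVneq l j) => [->|//] h; rewrite (leq_trans (leq_pred _)).
Qed.

(** If [i] precedes some variable of [u], exchanging that variable for [x_i] gives an earlier
    monomial of [M] dividing [x_i u]. Conversely, if no variable before the last one of [u] divides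
    [w], an earlier divisor of [w u] yields an earlier divisor of [u] by [divisor_before], against
    [~~ up T u]. *)
Lemma colon_up M T u : lex_closed M -> M u ->
  (forall t, (t \in T) = M t && before t u) -> ~~ up T u ->
  colon (up T) u =1 vars_below (\max_(j | u j != 0%N) j).
Proof.
move=> lexM Mu memT nTu w; apply/idP/existsP; last first.
  case=> i /andP[ik wi].
  have [j uj ij] : exists2 j : 'I_n, u j != 0%N & (i < j)%N.
    apply/exists_inP; apply: contraTT ik; rewrite negb_exists -leqNgt => /forallP h.
    by apply/bigmax_leqP => j uj; have := h j; rewrite uj -leqNgt.
  have nij : i != j by apply: contraTneq ij => ->; rewrite ltnn.
  apply/hasP; exists (exchange u i j).
    rewrite memT /before mdeg_exchange // eqxx ltmc_exchange // orbT andbT.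
    by apply: lexM Mu (ltmc_exchange ij uj); rewrite mdeg_exchange.
  apply/mnm_lepP => k; rewrite exchangeE // mnmDE.
  case: (eqVneq k i) => [->|_]; first by rewrite -add1n leq_add // lt0n.
  case: (eqVneq k j) => [->|_]; last exact: leq_addl.
  by rewrite (leq_trans (leq_pred _)) ?leq_addl.
case/hasP => t; rewrite memT => /andP[Mt tu] ltwu.
have [/existsP //|/existsPn hw] :=
  boolP [exists i : 'I_n, (i < \max_(j | u j != 0%N) j)%N && (w i != 0%N)].
case/negP: nTu; have [|t' [Mt' tu' leu]] := divisor_before lexM _ Mt tu ltwu.
  move=> i j ij wi; apply/eqP; apply: contraNT (hw i) => uj.
  by rewrite wi andbT (leq_trans ij) // (leq_bigmax_cond (F := fun j => val j)).
by apply/hasP; exists t' => //; rewrite memT Mt'.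
Qed.

(** The monomials of [M] of degree at most [D] are adjoined in the order [before]. Each is either a
    multiple of an earlier one or has a colon ideal generated by variables; the latter has bound 1,
    so the cone keeps the bound [D]. *)
Theorem resolves_lexsegment M D : up_closed M -> lex_closed M ->
  (forall u, M u -> exists t, [/\ M t, (mdeg t <= D)%N & (t <= u)%MM]) ->
  exists F : free_seq K n, resolves M D F.
Proof.
move=> upM lexM genM.
pose all_mon : seq 'X_{1..n} := [seq val x | x <- enum {: 'X_{1..n < D.+1}}].
pose E := sort before_eq [seq t <- all_mon | M t].
have memE t : (t \in E) = M t && (mdeg t <= D)%N.
  rewrite mem_sort mem_filter; congr (_ && _); apply/mapP/idP => [[x _ ->]|h].
    by rewrite -ltnS bmdeg.
  by exists (BMultinom (h : (mdeg t < D.+1)%N)); rewrite ?mem_enum.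
have uniqE : uniq E.
  by rewrite sort_uniq filter_uniq // map_inj_uniq ?enum_uniq //; apply: val_inj.
have sortE : pairwise before_eq E.
  by rewrite -sorted_pairwise ?sort_sorted //; [exact: before_eq_total | exact: before_eq_trans].
suff H s s' : E = s ++ s' -> exists F : free_seq K n, resolves (up s) D F.
  have [F rF] := H E [::] (esym (cats0 E)).
  exists F; apply: eq_resolves rF => w; apply/hasP/idP => [[t]|/genM [t [Mt tD tw]]].
    by rewrite memE => /andP[Mt _]; apply: upM.
  by exists t; rewrite // memE Mt.
elim/last_ind: s s' => [|s u IHs] s' eqE.
  have [F rF] := resolves_empty K n D; exists F.
  by apply: eq_resolves rF.
rewrite cat_rcons in eqE; have [F rF] := IHs _ eqE.
have upE : up (rcons s u) =1 adjoin (up s) u.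
  by move=> w; rewrite /up has_rcons orbC.
have [us|nus] := boolP (up s u).
  exists F; apply: eq_resolves rF => w; rewrite upE /adjoin.
  have [//|nw] := boolP (up s w); apply/esym; apply: contraNF nw => uw.
  case/hasP: us => t ts tu; apply/hasP; exists t => //; exact: lepm_trans tu uw.
have /andP[Mu uD] : M u && (mdeg u <= D)%N by rewrite -memE eqE mem_cat mem_head orbT.
(* As [E] is sorted without repetition, its prefix [s] consists of exactly the monomials of [M]
   before [u], as [colon_up] demands. *)
have memS t : (t \in s) = M t && before t u.
  move: sortE uniqE; rewrite eqE pairwise_cat cat_uniq /= => /and3P[/allrelP h1 _ /andP[/allP h2 _]].
  case/and3P => _ hs /andP[us' _]; apply/idP/andP => [ts|[Mt tu]].
    split; first by have := memE t; rewrite eqE mem_cat ts => /esym/andP[].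
    have := h1 t u ts (mem_head _ _); case/orP => // /eqP tu.
    by move: hs; rewrite negb_or -tu ts.
  have := memE t; rewrite Mt (leq_trans (leq_mdeg_before tu) uD) eqE mem_cat inE.
  case/or3P => // [/eqP tu'|/h2 /orP[/eqP ut|ut]].
  - by rewrite tu' before_irr in tu.
  - by rewrite ut before_irr in tu.
  - by have := before_trans tu ut; rewrite before_irr.
have le_n : (\max_(j | u j != 0%N) j <= n)%N.
  by apply/bigmax_leqP => j _; apply: ltnW.
have [G rG] := resolves_vars_below le_n.
have := resolves_cone rF (eq_resolves (fsym (colon_up lexM Mu memS nus)) rG) uD.
rewrite addn1 ltnS => /(_ uD) [H rH]; exists H.
by apply: eq_resolves rH => w; rewrite upE.
Qed.

End LexsegmentResolution.

(** * Regularity of monomial ideals *)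

Section MonomialIdeals.
Variables (K : fieldType) (n : nat) (M : pred 'X_{1..n}).
Local Notation S := {mpoly K[n]}.
Hypotheses (upM : up_closed M) (M0 : ~~ M 0%MM).

Lemma mono_in_ideal : idealr_closed (@mono_in K n M : {pred S}).
Proof.
split; first by rewrite unfold_in /mono_in msupp0.
  by rewrite unfold_in /mono_in -mpolyC1 msupp1 /= andbT.
move=> a p q; rewrite !unfold_in => /allP hp /allP hq; apply/allP => m.
move/msuppD_le; rewrite mem_cat => /orP[/msuppM_le /allpairsP [[m1 m2] /= [_ h2 ->]]|/hq //].
by apply: upM (hp _ h2) (lem_addl _ _).
Qed.

Definition mono_ideal : idealr S :=
  HB.pack_for (idealr S) (@mono_in K n M) (isIdealr.Build S (@mono_in K n M) mono_in_ideal).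

Lemma mem_mono_ideal p : (p \in mono_ideal) = mono_in M p.
Proof. by []. Qed.

Lemma mono_ideal_lexsegment : lex_closed M -> lexsegment_ideal mono_ideal.
Proof.
move=> lexM; split.
  exists M => p; rewrite mem_mono_ideal; split=> [/allP hp|[s [hs ->]]].
    exists [seq ((p@_m)%:MP, m) | m <- msupp p]; split.
      by move=> t /mapP [m hm ->]; apply: hp.
    by rewrite big_map {1}[p]mpolyE; apply: eq_bigr => m _; rewrite mul_mpolyC.
  rewrite big_seq -mem_mono_ideal; apply: rpred_sum => t ts; have ht := hs t ts.
  by apply: idealMr; rewrite mem_mono_ideal /mono_in msuppX /= andbT; exact: ht.
move=> u v uv; rewrite !mem_mono_ideal /mono_in !msuppX /= !andbT => Mu [i [eqi lti]].
by apply: (lexM _ _ uv Mu); apply/ltmcP => //; exists i => // j /eqi ->.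
Qed.

End MonomialIdeals.

Section Regularity.
Variables (K : fieldType) (n : nat) (M : pred 'X_{1..n}).
Local Notation S := {mpoly K[n]}.
Hypotheses (upM : up_closed M) (M0 : ~~ M 0%MM).
Local Notation I := (mono_ideal K upM M0).

Lemma pi_eq0 p : (\pi_{ideal_quot I} p == 0) = mono_in M p.
Proof.
rewrite -mem_mono_ideal -[p in RHS]subr0 Quotient.idealrBE raddf0.
by [].
Qed.

(** Prepending S in degree 0 turns a resolution of the ideal into one of S/I and moves the other
    modules up by one degree. *)
Definition quot_seq (F : free_seq K n) : augmented_free_seq I :=
  @AugmentedFreeSeq K n I
    (fun i => match i with 0 => 1%N | j.+1 => frk F j end)
    (fun i => match i return 'I_(match i with 0 => 1%N | j.+1 => frk F j end) -> int with
              | 0 => fun _ => 0 | j.+1 => @ftwz K n F j end)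
    (fun i => match i return 'M[S]_(frk F i, match i with 0 => 1%N | j.+1 => frk F j end) with
              | 0 => fgen F | j.+1 => fdif F j end)
    (fun _ => 1).

Lemma quot_seq_resolution D F : resolves M D F -> graded_free_resolution (quot_seq F).
Proof.
move=> rF; have augE v : aug_map (F := quot_seq F) v = \pi_{ideal_quot I} (v 0 0).
  by rewrite /aug_map big_ord1 mulr1.
split; [|split; [|split; [|split]]] => /=.
- move=> _; exists 1; split; last by rewrite rmorph1.
  by move=> m; rewrite -mpolyC1 msupp1 inE => /eqP ->; rewrite mdeg0.
- case=> [|i] a b; last exact: (res_dif_homog rF).
  by rewrite (ord1 b) subr0; apply: (res_gen_homog rF).
- by move=> x; exists (repr x)%:M; rewrite augE mxE mulr1n reprK.
- move=> v; rewrite augE [v]mx11_scalar mxE mulr1n -(res_image rF).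
  by rewrite -pi_eq0; split=> /eqP.
- case=> [|i] v; first exact: (res_exact0 rF).
  exact: (res_exact rF).
Qed.

(** A cycle that is not a boundary has a nonzero coordinate, whose twist is [j]. The bound [D.+1]
    for the ideal becomes [D] because of the shift by one homological degree. *)
Lemma quot_seq_Tor D F i j : resolves M D.+1 F -> Tor_neq0 (quot_seq F) i j -> j - i%:Z <= D%:Z.
Proof.
move=> rF [v [degv _ nbound]].
have [a va] : exists a, v 0 a != 0.
  apply/existsP; apply: contra_notT nbound; rewrite negb_exists => /forallP v0.
  exists 0; split; first by move=> a; rewrite mxE eqxx.
  by rewrite mul0mx; apply/rowP => a; rewrite mxE; apply/eqP; rewrite -[_ == _]negbK.
rewrite -(degv a va) /=; case: i v degv nbound a va => [|i] v degv nbound a va /=.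
  by rewrite subr0.
by rewrite lerBlDr -PoszD lez_nat addnS -addSn addnC (res_bound rF).
Qed.

Lemma mcoeff0_homog e (p : S) : has_degree e p -> e != 0 -> p@_0%MM = 0.
Proof. by move=> /has_degreeP hp e0; apply: hp; rewrite mdeg0 eq_sym. Qed.

Lemma meval_origin (p : S) : p.@[fun=> 0] = p@_0%MM.
Proof.
rewrite {1}[p]mpolyE raddf_sum /=.
transitivity (\sum_(m <- msupp p | m == 0%MM) p@_0%MM).
  rewrite [RHS]big_mkcond; apply: eq_bigr => m _; rewrite mevalZ mevalX.
  case: (eqVneq m 0%MM) => [->|]; first by rewrite big1 ?mulr1 // => i _; rewrite mnm0E expr0.
  rewrite -mdeg_eq0 mdegE sum_nat_eq0 negb_forall => /existsP [i /= mi].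
  by rewrite (bigD1 i) //= expr0n (negPf mi) mul0r mulr0.
have [h|h] := boolP (0%MM \in msupp p).
  by rewrite -big_filter filter_pred1_uniq ?msupp_uniq // big_seq1.
by rewrite (memN_msupp_eq0 h) big1.
Qed.

(** The upper bound comes from the twists. It is attained in Tor_1: when [X_[u]] is written through
    the generators, the constant terms of the coefficients form a class of degree [r.+1] that
    survives because [u] is a minimal generator. *)
Lemma mono_regularity r u : lex_closed M ->
  (forall w, M w -> exists t, [/\ M t, (mdeg t <= r.+1)%N & (t <= w)%MM]) ->
  M u -> mdeg u = r.+1 -> (forall t, M t -> (t <= u)%MM -> (r < mdeg t)%N) ->
  regularity I r%:Z.
Proof.
move=> lexM genM Mu du minu; have [F rF] := resolves_lexsegment K upM lexM genM.
exists (quot_seq F); split; first exact: quot_seq_resolution rF.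
  exists 1%N, (r.+1)%:Z; split; last by rewrite -addn1 PoszD addrK.
  have [v [hv vE]] : exists v, homog_mx (fun _ : 'I_1 => (r.+1)%:Z) (@ftwz K n F 0) v /\
      ('X_[u] : S)%:M = v *m fgen F.
    apply: (@homog_factor _ _ _ _ _ _ _ (fun _ : 'I_1 => 0)).
    - by move=> a b; rewrite !ord1 mxE mulr1n subr0 -du; apply: has_degreeX.
    - by move=> a b; rewrite !ord1 subr0; apply: (res_gen_homog rF).
    - move=> a; have [|w hw] := (res_image rF 'X_[u]).1; first by rewrite /mono_in msuppX /= Mu.
      by exists w; rewrite -hw; apply/rowP => b; rewrite !mxE !ord1.
  have genM0 a : (fgen F a 0)@_0%MM = 0.
    suff /mono_inP : mono_in M (fgen F a 0) by exact.
    apply/(res_image rF); exists (delta_mx 0 a); rewrite -rowE.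
    by apply/rowP => b; rewrite !mxE !ord1.
  pose v0 : 'rV[K]_(frk F 0) := map_mx (meval (fun=> 0)) v.
  exists (v0 : 'rV_(rk (quot_seq F) 1)); split.
  - move=> a; rewrite mxE meval_origin => va; apply/eqP; rewrite eq_sym -subr_eq0.
    by apply: contraNT va => e0; rewrite (mcoeff0_homog (hv 0 a) e0).
  (* After tensoring with K the map to degree 0 vanishes, since the generators have no constant
     term. *)
  - apply/rowP => b; rewrite !mxE big1 // => a _.
    by rewrite !mxE (ord1 b) !meval_origin genM0 mulr0.
  (* If the constant terms were the boundary of [w], subtracting the boundary of the constant lift
     of [w] would leave coefficients without constant term. *)
  case=> w [_ /= v0E]; pose v' := v - map_mx (@mpolyC n K) w *m fdif F 0.
  have v'E : ('X_[u] : S)%:M = v' *m fgen F.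
    by rewrite mulmxBl -mulmxA (exact_mul0 (res_exact0 rF)) mulmx0 subr0.
  have v'0 a : (v' 0 a)@_0%MM = 0.
    have := congr1 (fun x : 'rV_(frk F 0) => x 0 a) v0E; rewrite mxE => va.
    rewrite -meval_origin /v' mxE mevalD [X in _ + meval _ X]mxE mevalN va.
    rewrite !mxE (raddf_sum (meval _)) -sumrB big1 // => b _.
    by rewrite !mxE [X in _ - X]mevalM mevalC subrr.
  have : ('X_[u] : S)@_u != 0 by rewrite mcoeffX eqxx oner_eq0.
  have -> : ('X_[u] : S) = \sum_a v' 0 a * fgen F a 0.
    by move/matrixP/(_ 0 0): v'E; rewrite !mxE mulr1n.
  rewrite raddf_sum /= => /eqP; apply; apply: big1 => a _; apply/eqP.
  (* The monomial [u] would then be a proper multiple of a monomial of [M], which therefore has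
     degree at most [r]. *)
  rewrite mcoeff_eq0; apply/negP => /msuppM_le /allpairsP [[m1 m2] /= [h1 h2 uE]].
  have Mm2 : M m2.
    suff /allP : mono_in M (fgen F a 0) by apply.
    apply/(res_image rF); exists (delta_mx 0 a); rewrite -rowE.
    by apply/rowP => b; rewrite !mxE !ord1.
  have := minu m2 Mm2; rewrite uE lem_addl => /(_ isT).
  rewrite ltnNge -ltnS -du uE mdegD -[X in (X < _)%N]add0n ltn_add2r lt0n mdeg_eq0.
  by case: eqP h1 => // ->; rewrite mcoeff_msupp v'0 eqxx.
by move=> i j; apply: quot_seq_Tor.
Qed.

End Regularity.

(** * Hilbert functions and Krull dimension *)

Definition monomials n d : seq 'X_{1..n} :=
  [seq s2m (val t) | t : d.-tuple 'I_n <- enum (basis n d)].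

Lemma mem_monomials n d (m : 'X_{1..n}) : (m \in monomials n d) = (mdeg m == d).
Proof. exact/esym/basis_cover. Qed.

Lemma uniq_monomials n d : uniq (monomials n d).
Proof. exact: uniq_basis. Qed.

Lemma size_monomials n d : size (monomials n.+1 d) = 'C(d + n, d).
Proof. exact: size_basis. Qed.

Section HilbertFunction.
Variables (K : fieldType) (n : nat) (M : pred 'X_{1..n}).
Local Notation S := {mpoly K[n]}.
Hypotheses (upM : up_closed M) (M0 : ~~ M 0%MM).
Local Notation I := (mono_ideal K upM M0).

Definition standard_monomials d := [seq m <- monomials n d | ~~ M m].

Lemma mono_hilbert_function :
  hilbert_function I (fun d => size (standard_monomials d)).
Proof.
move=> d; set L := standard_monomials d; pose X (i : 'I_(size L)) := nth 0%MM L i.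
have memL m : (m \in L) = ~~ M m && (mdeg m == d) by rewrite mem_filter mem_monomials.
have XL i : X i \in L by rewrite mem_nth.
have coefL (c : 'rV[K]_(size L)) j : (\sum_i c 0 i *: ('X_[X i] : S))@_(X j) = c 0 j.
  rewrite raddf_sum /= (bigD1 j) //= mcoeffZ mcoeffX eqxx mulr1 big1 ?addr0 // => i ij.
  rewrite mcoeffZ mcoeffX nth_uniq ?filter_uniq ?uniq_monomials //.
  by rewrite val_eqE (negPf ij) mulr0.
(* Congruence modulo the ideal is equality of the coefficients at standard monomials. *)
have piE (p : S) (c : 'rV[K]_(size L)) : p \is d.-homog ->
    (\pi_{ideal_quot I} p = \pi_{ideal_quot I} (\sum_i c 0 i *: 'X_[X i])) <->
    (forall i, p@_(X i) = c 0 i).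
  move=> homp; rewrite (rwP eqP) -Quotient.idealrBE mem_mono_ideal.
  split=> [/mono_inP h i|h].
    have := XL i; rewrite memL => /andP[/h + _]; rewrite mcoeffB => /eqP.
    by rewrite subr_eq0 => /eqP ->; apply: coefL.
  apply/mono_inP => m Mm; rewrite mcoeffB.
  have [md|md] := eqVneq (mdeg m) d.
    have mL : m \in L by rewrite memL Mm md eqxx.
    have -> : m = X (Ordinal (etrans (index_mem _ _) mL)) by rewrite /X nth_index.
    by rewrite h; apply/eqP; rewrite subr_eq0; apply/eqP/esym/coefL.
  rewrite (dhomog_nemf_coeff homp md) raddf_sum big1 ?subrr // => i _ /=.
  rewrite mcoeffZ mcoeffX; case: eqP => [eqm|]; last by rewrite mulr0.
  by have := XL i; rewrite eqm memL (negPf md) andbF.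
exists (fun i => 'X_[X i]); split=> [i|p homp].
  by have := XL i; rewrite memL dhomogX => /andP[].
exists (\row_i p@_(X i)); split; first by apply/(piE _ _ homp) => i; rewrite mxE.
by move=> c /(piE _ _ homp) h; apply/rowP => i; rewrite mxE.
Qed.

End HilbertFunction.

(** * Chains of primes and algebraic independence *)

Section PrimeChains.
Variable R : comNzRingType.

Definition ideal_of (P : {pred R}) (hP : idealr_closed P) : idealr R :=
  HB.pack_for (idealr R) (P : R -> bool) (isIdealr.Build R P hP).

Fixpoint monomial_in (f : nat -> R) (j : seq nat) : R :=
  match j with [::] => 1 | a :: j' => f 0%N ^+ a * monomial_in (fun i => f i.+1) j' end.

(* Elements [f i] in [P i.+1] but not in [P i] are algebraically independent:
   among the terms with the least exponent of [f 0], that power cancels modulo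
   the prime [P 0], and the other terms vanish modulo [P 1]. *)
Lemma prime_chain_independent (T : eqType) e (P : nat -> {pred R}) (f : nat -> R)
    (L : seq T) (J : T -> seq nat) (c : T -> R) :
  prime_chain e P -> (forall i, (i < e)%N -> f i \in P i.+1 /\ f i \notin P i) ->
  uniq L -> {in L &, injective J} -> {in L, forall t, size (J t) = e} -> L != [::] ->
  {in L, forall t, c t \notin P e} ->
  \sum_(t <- L) c t * monomial_in f (J t) \notin P 0%N.
Proof.
elim: e P f L J c => [|e IHe] P f L J c [primeP subP] hf uL injJ sizeJ L0 hc.
  (* For chain length 0 all exponent lists are empty, so injectivity of [J] leaves a single term. *)
  case: L L0 uL injJ sizeJ hc => [//|t [|t' L]] _ uL injJ sizeJ hc.
    by rewrite big_seq1 (size0nil (sizeJ t (mem_head _ _))) mulr1 hc ?mem_head.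
  have tL : t \in [:: t, t' & L] by rewrite mem_head.
  have t'L : t' \in [:: t, t' & L] by rewrite inE mem_head orbT.
  have tt' : t = t' by apply: injJ => //; rewrite !(size0nil (sizeJ _ _)).
  by move: uL; rewrite /= tt' mem_head.
have [hP0 primeP0] := primeP 0%N isT; have [hP1 _] := primeP 1%N isT.
pose Q0 := ideal_of hP0; pose Q1 := ideal_of hP1.
have [a /hasP [t0 t0L /eqP ht0] min_a] :
    {a | has (fun t => head 0%N (J t) == a) L & forall t, t \in L -> (a <= head 0%N (J t))%N}.
  have ex : exists a, has (fun t => head 0%N (J t) == a) L.
    case: L L0 {uL injJ sizeJ hc} => // t L _; exists (head 0%N (J t)).
    by rewrite /= eqxx.
  case: (ex_minnP ex) => a ha mina; exists a => // t tL; apply: mina.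
  by apply/hasP; exists t.
have JE t : t \in L -> J t = head 0%N (J t) :: behead (J t).
  by move=> /sizeJ; case: (J t).
pose f' i := f i.+1.
pose term t := c t * (f 0%N ^+ (head 0%N (J t) - a) * monomial_in f' (behead (J t))).
have -> : \sum_(t <- L) c t * monomial_in f (J t) = f 0%N ^+ a * \sum_(t <- L) term t.
  rewrite mulr_sumr; apply: eq_big_seq => t tL; rewrite {1}(JE t tL) /= /term.
  by rewrite [RHS]mulrCA; congr (_ * _); rewrite mulrA -exprD subnKC ?min_a.
have [f1 f0] := hf 0%N isT.
have f0a k : f 0%N ^+ k \notin P 0%N.
  elim: k => [|k IHk]; first by have [] := hP0.
  by rewrite exprS; apply/negP => /primeP0; rewrite (negPf f0) (negPf IHk).
apply/negP => /primeP0; rewrite (negPf (f0a a)) /= => /((subP 0%N isT).1).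
rewrite (bigID (fun t => head 0%N (J t) == a)) /=.
set A := \sum_(t <- L | _) _; set B := \sum_(t <- L | _) _ => AB.
(* The terms of [B] keep a positive power of [f 0], which lies in [P 1]. *)
have Q1B : B \in Q1.
  rewrite /B big_seq_cond; apply: rpred_sum => t /andP[tL ta].
  rewrite /term mulrCA; have : (0 < head 0%N (J t) - a)%N.
    by rewrite subn_gt0 ltn_neqAle eq_sym ta min_a.
  case: (_ - a)%N => // k _; rewrite exprSr -mulrA mulrCA mulrC.
  by apply: idealMr; apply: f1.
have : A \in Q1 by rewrite -(addrK B A) rpredB.
apply/negP; have -> : A =
    \sum_(t <- [seq t <- L | head 0%N (J t) == a]) c t * monomial_in f' (behead (J t)).
  by rewrite big_filter; apply: eq_bigr => t /eqP ta; rewrite /term ta subnn expr0 mul1r.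
apply: (IHe (fun i => P i.+1) f' _ (behead \o J)).
- by split=> i ie; [apply: primeP | apply: subP].
- by move=> i ie; apply: hf.
- exact: filter_uniq.
- move=> t t'; rewrite !mem_filter => /andP[/eqP ta tL] /andP[/eqP ta' tL'] /= eqb.
  by apply: injJ => //; rewrite (JE t tL) (JE t' tL') ta ta' eqb.
- by move=> t; rewrite mem_filter => /andP[_ tL]; rewrite size_behead sizeJ.
- by apply/eqP => h; have : t0 \in [::] by rewrite -[in X in _ \in X]h mem_filter t0L ht0 eqxx.
- by move=> t; rewrite mem_filter => /andP[_ tL]; apply: hc.
Qed.

End PrimeChains.

Section KrullDimension.
Variables (K : fieldType) (n : nat).
Local Notation S := {mpoly K[n]}.

Definition deg_le k (p : S) := all (fun m => mdeg m <= k)%N (msupp p).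

Lemma deg_leM j k p q : deg_le j p -> deg_le k q -> deg_le (j + k) (p * q).
Proof.
move=> /allP hp /allP hq; apply/allP => m /msuppM_le /allpairsP [[m1 m2] /= [h1 h2 ->]].
by rewrite mdegD leq_add ?hp ?hq.
Qed.

Lemma deg_leX k p a : deg_le k p -> deg_le (k * a) (p ^+ a).
Proof.
move=> hp; elim: a => [|a IHa]; last by rewrite exprS mulnS deg_leM.
by rewrite /deg_le expr0 msupp1 /= mdeg0 andbT.
Qed.

Lemma deg_le_monomial_in k (g : nat -> S) j : (forall i, (i < size j)%N -> deg_le k (g i)) ->
  deg_le (k * sumn j) (monomial_in g j).
Proof.
elim: j g => [|a j IHj] g hg /=; first by rewrite muln0 /deg_le msupp1 /= mdeg0.
rewrite mulnDr deg_leM ?deg_leX ?(hg 0%N) //; apply: IHj => i ij; exact: hg.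
Qed.

Lemma rmorph_monomial_in (R1 R2 : comNzRingType) (h : {rmorphism R1 -> R2}) g j :
  h (monomial_in g j) = monomial_in (h \o g) j.
Proof.
by elim: j g => [|a j IHj] g /=; rewrite ?rmorph1 // rmorphM rmorphXn IHj.
Qed.

Lemma eq_monomial_in (R : comNzRingType) (f g : nat -> R) j :
  f =1 g -> monomial_in f j = monomial_in g j.
Proof.
elim: j f g => //= a j IHj f g fg; rewrite fg; congr (_ * _).
by apply: IHj => i; apply: fg.
Qed.

Variable M : pred 'X_{1..n}.
Hypotheses (upM : up_closed M) (M0 : ~~ M 0%MM).
Local Notation I := (mono_ideal K upM M0).
Local Notation Q := {ideal_quot I}.

(** A longer chain would give [d.+1] independent elements. Their power products with exponents below
    [N] number [N ^ d.+1] and have degree linear in [N], whereas the quotient has dimension of order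
    [N ^ d] up to such degrees; so for large [N] they are linearly dependent over K. *)
Lemma prime_chain_bound C d :
  (forall N, exists B : seq 'X_{1..n}, (size B <= C * N.+1 ^ d)%N /\
     forall u, ~~ M u -> (mdeg u <= N)%N -> u \in B) ->
  forall e P, prime_chain (R := Q) e P -> (e <= d)%N.
Proof.
move=> hB e P chainP; rewrite leqNgt; apply/negP => lt_de.
have {chainP lt_de e} chainP : prime_chain d.+1 P.
  by case: chainP => h1 h2; split=> i hi; [apply: h1 | apply: h2]; apply: leq_trans hi _.
have [f hf] : exists f : nat -> Q, forall i, (i < d.+1)%N -> f i \in P i.+1 /\ f i \notin P i.
  suff ex i : exists x : Q, (i < d.+1)%N -> x \in P i.+1 /\ x \notin P i.
    exists (fun i => proj1_sig (constructive_indefinite_description _ (ex i))) => i.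
    by case: constructive_indefinite_description.
  have [id|] := ltnP i d.+1; last by exists 0.
  have [_ nsub] := chainP.2 i id; apply: NNPP => nex; apply: nsub => x xP.
  by apply/negPn/negP => nx; apply: nex; exists x.
pose g i : S := repr (f i); pose c := \max_(i < d.+1) msize (g i).
have gc i : (i < d.+1)%N -> deg_le c (g i).
  move=> id; apply/allP => m /msize_mdeg_lt /ltnW h; apply: leq_trans h _.
  exact: (leq_bigmax (F := fun i : 'I_d.+1 => msize (g i)) (Ordinal id)).
(* [N] exceeds [C * (c * d.+1).+1 ^ d], which makes the number [N ^ d.+1] of power products larger
   than [C * W.+1 ^ d]; [W] bounds their degrees. *)
pose N := (C * (c * d.+1).+1 ^ d).+1; pose W := (c * (d.+1 * N))%N.
have [B [szB hBW]] := hB W.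
pose T := (d.+1).-tuple 'I_N; pose J (t : T) : seq nat := map val t.
have szJ t : size (J t) = d.+1 by rewrite size_map size_tuple.
have lt_card : (size B < #|{: T}|)%N.
  rewrite card_tuple card_ord; apply: leq_ltn_trans szB _.
  have le_W : (W.+1 <= (c * d.+1).+1 * N)%N by rewrite /W [X in (_ <= X)%N]mulSn mulnA -addn1 addnC leq_add2r.
  apply: (@leq_ltn_trans (C * ((c * d.+1).+1 * N) ^ d)%N).
    by rewrite leq_mul2l; case: (d) le_W => [|d'] le_W; rewrite ?expn0 ?leq_exp2r ?le_W ?orbT.
  by rewrite expnMn mulnA expnS ltn_pmul2r // expn_gt0.
pose q (t : T) := monomial_in g (J t).
have degq t : deg_le W (q t).
  have /allP hq : deg_le (c * sumn (J t)) (q t).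
    by apply: deg_le_monomial_in => i; rewrite szJ; apply: gc.
  apply/allP => m /hq h; rewrite (leq_trans h) // leq_mul2l -(szJ t) /J; apply/orP; right.
  elim: (tval t) => //= i s IHs; rewrite mulSn leq_add // ltnW //.
(* The matrix has more rows than columns, so a nonzero row vector annihilates it: a relation modulo
   the ideal. *)
pose A : 'M[K]_(#|{: T}|, size B) := \matrix_(t, b) (q (enum_val t))@_(nth 0%MM B b).
have /rowV0Pn [x /sub_kermxP xA x0] : kermx A != 0.
  rewrite -mxrank_eq0 mxrank_ker subn_eq0 -ltnNge.
  exact: leq_ltn_trans (rank_leq_col A) lt_card.
pose a t := x 0 (enum_rank t).
have sumI : mono_in M (\sum_t (a t)%:MP * q t).
  apply/mono_inP => m Mm; rewrite raddf_sum /=.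
  have [mW|Wm] := leqP (mdeg m) W; last first.
    rewrite big1 // => t _; rewrite mcoeffCM memN_msupp_eq0 ?mulr0 //.
    by apply/negP => /(allP (degq t)); rewrite leqNgt Wm.
  have mB := hBW m Mm mW; have lt_mB : (index m B < size B)%N by rewrite index_mem.
  move/rowP/(_ (Ordinal lt_mB)): xA; rewrite !mxE => xA; rewrite -[RHS]xA.
  rewrite (reindex (fun i : (ordinal #|{: T}|) => enum_val i)) /=; last first.
    exact: (onW_bij _ (@enum_val_bij T)).
  by apply: eq_bigr => t _; rewrite mxE mcoeffCM /a enum_valK nth_index.
have [h1 _] := chainP.1 d.+1 (leqnn _); have [h0 _] := chainP.1 0%N isT.
have aP t : a t != 0 -> \pi_Q (a t)%:MP \notin P d.+1.
  move=> at0; case: h1 => _ n1 h1; apply: contra n1 => ha.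
  have -> : 1 = \pi_Q (a t)^-1%:MP * \pi_Q (a t)%:MP + 0.
    by rewrite addr0 -rmorphM -mpolyCM mulVf // mpolyC1 rmorph1.
  by apply: h1 => //; case: (chainP.1 d.+1 (leqnn _)) => [[]].
have : \sum_(t <- [seq t <- enum {: T} | a t != 0]) \pi_Q (a t)%:MP * monomial_in f (J t)
    \notin P 0%N.
  apply: (prime_chain_independent chainP hf).
  - exact/filter_uniq/enum_uniq.
  - by move=> t t' _ _ /(inj_map val_inj) /val_inj.
  - by move=> t _; apply: szJ.
  - have [t at0] : exists t, a t != 0.
      have [i] := rV0Pn _ x0; exists (enum_val i); rewrite /a enum_valK //.
    by apply/eqP => h; have : t \in [::] by rewrite -[in X in _ \in X]h mem_filter at0 mem_enum.
  - by move=> t; rewrite mem_filter => /andP[/aP].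
suff -> : \sum_(t <- [seq t <- enum {: T} | a t != 0]) \pi_Q (a t)%:MP * monomial_in f (J t) = 0.
  by case: h0 => ->.
move: sumI; rewrite -(pi_eq0 upM M0) raddf_sum /= => /eqP e.
rewrite -[RHS]e big_filter big_mkcond big_enum /=; apply: eq_bigr => t _.
rewrite rmorphM /q rmorph_monomial_in; case: eqP => [->|_] /=.
  by rewrite mpolyC0 rmorph0 mul0r.
by congr (_ * _); apply: eq_monomial_in => i; rewrite /= reprK.
Qed.

End KrullDimension.

(** * Coordinate primes and the Krull dimension *)

Section CoordinateChain.
Variables (K : fieldType) (n : nat).
Local Notation S := {mpoly K[n]}.

(** A ring endomorphism of the domain S whose kernel is the ideal of the first [k] variables;
    primality of that ideal is read off from it. *)
Definition kill_below k (p : S) : S :=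
  p \mPo [tuple (if (i < k)%N then 0 else 'X_i) | i < n].

Lemma kill_belowX k m :
  kill_below k 'X_[m] = if vars_below k m then 0 else 'X_[m].
Proof.
rewrite /kill_below comp_mpolyX; have [/existsP [i /andP[ik mi]]|/existsPn nk] := boolP (vars_below k m).
  by rewrite (bigD1 i) //= tnth_mktuple ik expr0n (negPf mi) mul0r.
rewrite [RHS]mpolyXE_id; apply: eq_bigr => i _; rewrite tnth_mktuple.
case: ifP => // ik; have [->|mi] := eqVneq (m i) 0%N; first by rewrite !expr0.
by have := nk i; rewrite ik mi.
Qed.

Lemma mcoeff_kill_below k p m :
  (kill_below k p)@_m = if vars_below k m then 0 else p@_m.
Proof.
rewrite {1}[p]mpolyE /kill_below (linear_sum (comp_mpoly _)) raddf_sum.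
transitivity (\sum_(l <- msupp p | l == m) (if vars_below k m then 0 else p@_m)).
  rewrite [RHS]big_mkcond /=; apply: eq_bigr => l _.
  rewrite comp_mpolyZ -/(kill_below k _) kill_belowX.
  case: (eqVneq l m) => [->|lm]; case: ifP => _; rewrite ?scaler0 ?mcoeff0 //.
    by rewrite mcoeffZ mcoeffX eqxx mulr1.
  by rewrite mcoeffZ mcoeffX (negPf lm) mulr0.
have [h|h] := boolP (m \in msupp p).
  by rewrite -big_filter filter_pred1_uniq ?msupp_uniq // big_seq1.
by rewrite (memN_msupp_eq0 h) if_same big1.
Qed.

Lemma kill_below_eq0 k p : (kill_below k p == 0) = mono_in (vars_below k) p.
Proof.
apply/eqP/mono_inP => [h m /negPf mk|h].
  by have := mcoeff_kill_below k p m; rewrite h mcoeff0 mk.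
by apply/mpolyP => m; rewrite mcoeff_kill_below mcoeff0; case: ifP => // /negbT /h.
Qed.

Lemma up_vars_below k : up_closed (@vars_below n k).
Proof.
move=> u w /existsP [i /andP[ik ui]] /mnm_lepP/(_ i) uw; apply/existsP; exists i.
by rewrite ik -lt0n (leq_trans _ uw) // lt0n.
Qed.

Lemma vars_below0 k : ~~ @vars_below n k 0%MM.
Proof. by apply/existsPn => i; rewrite mnm0E andbF. Qed.

Variable M : pred 'X_{1..n}.
Hypotheses (upM : up_closed M) (M0 : ~~ M 0%MM).
Local Notation I := (mono_ideal K upM M0).
Local Notation Q := {ideal_quot I}.

(** The test uses the chosen representative; [coord_primeE] shows that any other gives the same
    answer when [M] lies in [vars_below k]. *)
Definition coord_prime k : {pred Q} := [pred x | mono_in (vars_below k) (repr x : S)].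

Lemma coord_primeE k p : subpred M (vars_below k) ->
  (\pi_Q p \in coord_prime k) = mono_in (vars_below k) p.
Proof.
move=> sub; rewrite inE -!(mem_mono_ideal (@up_vars_below k) (vars_below0 k)).
have h : p - repr (\pi_Q p) \in mono_ideal K (@up_vars_below k) (vars_below0 k).
  rewrite mem_mono_ideal; apply: (sub_all sub).
  by rewrite -/(mono_in M _) -(mem_mono_ideal upM M0) Quotient.idealrBE reprK.
by rewrite -[p in RHS](subrK (repr (\pi_Q p))) rpredDl.
Qed.

Lemma prime_coord_prime k : subpred M (vars_below k) -> prime_ideal (coord_prime k).
Proof.
move=> sub; pose J := mono_ideal K (@up_vars_below k) (vars_below0 k).
have E p : (\pi_Q p \in coord_prime k) = (p \in J) by rewrite coord_primeE.
split; [split|].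
- by rewrite -(rmorph0 \pi_Q) E rpred0.
- by rewrite -(rmorph1 \pi_Q) E idealr1.
- move=> a x y; rewrite -[a]reprK -[x]reprK -[y]reprK !E -rmorphM -rmorphD E => hx hy.
  by rewrite rpredD // idealMr.
move=> x y; rewrite -[x]reprK -[y]reprK -rmorphM !coord_primeE // -!kill_below_eq0.
by rewrite /kill_below rmorphM mulf_eq0.
Qed.

(** The lower bound is the chain of ideals of the first n - d, ..., n variables, each step separated
    by a variable. *)
Lemma mono_krull_dim d C : (d <= n)%N -> subpred M (vars_below (n - d)) ->
  (forall N, exists B : seq 'X_{1..n}, (size B <= C * N.+1 ^ d)%N /\
     forall u, ~~ M u -> (mdeg u <= N)%N -> u \in B) ->
  krull_dim Q d.
Proof.
move=> dn sub hB; split; last exact: prime_chain_bound hB.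
have subk k l : (k <= l)%N -> subpred (@vars_below n k) (vars_below l).
  move=> kl m /existsP [i /andP[ik mi]]; apply/existsP; exists i.
  by rewrite (leq_trans ik kl).
have subM i : subpred M (vars_below (n - d + i)).
  by move=> m /sub; apply: subk; apply: leq_addr.
exists (fun i => coord_prime (n - d + i)); split=> i id; first exact: prime_coord_prime.
split.
  by move=> x; rewrite -[x]reprK !coord_primeE //; apply/sub_all/subk; rewrite addnS.
have lt_n : (n - d + i < n)%N by rewrite -[X in (_ < X)%N](subnK dn) ltn_add2l.
move/(_ (\pi_Q 'X_(Ordinal lt_n))); rewrite !coord_primeE // /mono_in msuppX /= !andbT.
have h : vars_below (n - d + i.+1) U_(Ordinal lt_n)%MM.
  by apply/existsP; exists (Ordinal lt_n); rewrite mnm1E eqxx /= addnS ltnSn.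
move=> /(_ h) /existsP [j]; rewrite mnm1E eqb0 negbK => /andP[jn /eqP ej].
by rewrite -ej /= ltnn in jn.
Qed.

End CoordinateChain.

(** * The case s <= r *)

Section Differences.
Implicit Type f : nat -> int.

Definition conv f d k : int :=
  \sum_(i < k.+1) f i * ((1 - 'X) ^+ d : {poly int})`_(k - i).

Definition delta f k : int := f k - (if k is k'.+1 then f k' else 0).

Lemma conv0 f k : conv f 0 k = f k.
Proof.
rewrite /conv big_ord_recr big1 /= ?add0r ?subnn ?coef1 ?mulr1 // => i _.
by rewrite coef1 subn_eq0 leqNgt ltn_ord mulr0.
Qed.

(** Multiplying a series by one factor [1 - 'X] takes backward differences, with value 0 before
    index 0. *)
Lemma conv_delta f d k : conv f d.+1 k = conv (delta f) d k.
Proof.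
pose F : {poly int} := \poly_(i < k.+1) f i.
have -> : conv f d.+1 k = (F * (1 - 'X) ^+ d.+1)`_k.
  by rewrite coefM; apply: eq_bigr => i _; rewrite coef_poly ltn_ord.
rewrite exprS mulrA coefM; apply: eq_bigr => i _; congr (_ * _).
rewrite mulrBr mulr1 coefB coefMX !coef_poly ltn_ord /delta.
by case: (i : nat) (ltn_ord i) => //= j /ltnW ->.
Qed.

Lemma eq_conv f g d k : (forall i, (i <= k)%N -> f i = g i) -> conv f d k = conv g d k.
Proof. by move=> fg; apply: eq_bigr => i _; rewrite fg // -ltnS. Qed.

Lemma convD f g d k : conv (fun i => f i + g i) d k = conv f d k + conv g d k.
Proof. by rewrite -big_split; apply: eq_bigr => i _; rewrite mulrDl. Qed.

Lemma convN f d k : conv (fun i => - f i) d k = - conv f d k.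
Proof. by rewrite -sumrN; apply: eq_bigr => i _; rewrite mulNr. Qed.

End Differences.

Section Divisors.
Variable n : nat.

Lemma divisor_of_degree (u : 'X_{1..n}) k : (k <= mdeg u)%N ->
  exists2 t, (t <= u)%MM & mdeg t = k.
Proof.
move dE : (mdeg u - k)%N => d; elim: d u dE => [|d IHd] u dE ku.
  by exists u; [exact: lepm_refl | apply/eqP; rewrite eqn_leq ku -subn_eq0 dE].
have u0 : mdeg u != 0%N by apply: contra_eqN dE => /eqP ->.
have [i ui] : exists i, u i != 0%N.
  apply/existsP; apply: contraNT u0 => /existsPn h; rewrite mdegE big1 // => i _.
  by apply/eqP/negPn/h.
have le_u : (U_(i) <= u)%MM by rewrite lep1mP.
have du : mdeg u = (mdeg (u - U_(i))).+1 by rewrite -addn1 -(mdeg1 i) -mdegD submK.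
have ki : (k <= mdeg (u - U_(i)))%N.
  by rewrite -ltnS -du ltn_neqAle ku andbT; apply: contra_eqN dE => /eqP ->; rewrite subnn.
have [|//|t tu tk] := IHd (u - U_(i))%MM.
  by apply/eqP; rewrite -eqSS -dE du subSn.
by exists t => //; apply: lepm_trans tu (lem_subr _ _).
Qed.

Lemma mdeg_lem (u w : 'X_{1..n}) : (u <= w)%MM -> (mdeg u <= mdeg w)%N.
Proof. by move=> uw; rewrite -(submK uw) mdegD leq_addl. Qed.

Lemma mdeg_ge (u : 'X_{1..n}) i : (u i <= mdeg u)%N.
Proof. by rewrite mdegE (bigD1 i) //= leq_addr. Qed.

End Divisors.

(** * Lexicographic rank within a degree *)

Section LexRank.
Variable n : nat.
Implicit Types u v w : 'X_{1..n}.

Definition lex_rank u := size [seq v <- monomials n (mdeg u) | (v < u)%O].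

Lemma ltn_lex_rank u v : mdeg u = mdeg v -> (u < v)%O -> (lex_rank u < lex_rank v)%N.
Proof.
move=> duv uv; apply: (@uniq_leq_size _ (u :: [seq w <- monomials n (mdeg u) | (w < u)%O])).
  by rewrite /= mem_filter ltxx filter_uniq ?uniq_monomials.
move=> w; rewrite inE !mem_filter !mem_monomials -duv => /orP[/eqP ->|/andP[wu ->]].
  by rewrite uv eqxx.
by rewrite (lt_trans wu uv).
Qed.

(** Multiplication by [w / u] injects the monomials below [u] into those below [w]. *)
Lemma leq_lex_rank_lem u w : (u <= w)%MM -> (lex_rank u <= lex_rank w)%N.
Proof.
move=> uw; rewrite -(submK uw) addmC; set z := (w - u)%MM.
rewrite /lex_rank -(size_map (fun v => v + z)%MM); apply: uniq_leq_size.
  by rewrite map_inj_uniq ?filter_uniq ?uniq_monomials //; apply: addIm.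
move=> _ /mapP [v + ->]; rewrite !mem_filter !mem_monomials !mdegD => /andP[vu /eqP ->].
by rewrite ltmc_add2l vu eqxx.
Qed.

(** In one degree the rank is injective with values below the number of monomials, hence a bijection
    onto an initial segment of the naturals. *)
Lemma count_lex_rank d k : (k <= size (monomials n d))%N ->
  size [seq u <- monomials n d | (lex_rank u < k)%N] = k.
Proof.
move=> kN; set L := monomials n d in kN *.
have memL u : u \in L -> mdeg u = d by rewrite mem_monomials => /eqP.
have injL : {in L &, injective lex_rank}.
  move=> u v uL vL e; case: (ltgtP u v) => // h.
    by have := ltn_lex_rank (etrans (memL u uL) (esym (memL v vL))) h; rewrite e ltnn.
  by have := ltn_lex_rank (etrans (memL v vL) (esym (memL u uL))) h; rewrite e ltnn.
have permL : perm_eq (map lex_rank L) (iota 0 (size L)).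
  have uL : uniq (map lex_rank L) by rewrite (map_inj_in_uniq injL); apply: uniq_monomials.
  apply: uniq_perm => //; first exact: iota_uniq.
  suff sub : {subset map lex_rank L <= iota 0 (size L)}.
    by apply: (uniq_min_size uL sub _).2; rewrite size_iota (size_map lex_rank).
  move=> _ /mapP [u uL' ->]; rewrite mem_iota /= add0n /lex_rank (memL u uL').
  rewrite size_filter -/L ltn_neqAle count_size andbT -all_count; apply/allPn.
  by exists u => //; rewrite ltxx.
rewrite size_filter -(count_map lex_rank (fun i => i < k)%N) (permP permL).
by rewrite -size_filter (@filter_iota_ltn 0) // size_iota.
Qed.

End LexRank.

(** * Monomials in the last two variables *)

Section LexTail.
Variable r : nat.
Local Notation n := r.+2.
Implicit Types u v w t : 'X_{1..n}.

Definition pen : 'I_n := inord r.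

Lemma pen_val : val pen = r.
Proof. by rewrite /= inordK. Qed.

Definition is_tail u := [forall i : 'I_n, (i < r)%N ==> (u i == 0%N)].

(** For [a <= d] these are the [d.+1] lexicographically smallest monomials of degree [d], increasing
    in [a], so that the rank of [tail_mon d a] is [a]. *)
Definition tail_mon d a : 'X_{1..n} := (U_(pen) *+ a + U_(ord_max) *+ (d - a))%MM.

Lemma mdeg_tail_mon d a : (a <= d)%N -> mdeg (tail_mon d a) = d.
Proof. by move=> ad; rewrite mdegD !mdegMn !mdeg1 !mul1n subnKC. Qed.

Lemma tail_mon_pen d a : tail_mon d a pen = a.
Proof.
rewrite mnmDE !mulmnE !mnm1E eqxx -val_eqE pen_val /=.
by rewrite (gtn_eqF (ltnSn r)) mul0n addn0 mul1n.
Qed.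

Lemma tail_mon_small d a (i : 'I_n) : (i < r)%N -> tail_mon d a i = 0%N.
Proof.
move=> ir; rewrite mnmDE !mulmnE !mnm1E -!val_eqE pen_val /=.
by rewrite (gtn_eqF ir) (gtn_eqF (leqW ir)).
Qed.

Lemma is_tailP u : reflect (u = tail_mon (mdeg u) (u pen)) (is_tail u).
Proof.
apply: (iffP forallP) => [ut|-> i]; last by apply/implyP => /tail_mon_small ->.
have du : mdeg u = (u pen + u ord_max)%N.
  rewrite mdegE (bigD1 ord_max) //= (bigD1 pen) /=; last by rewrite -val_eqE pen_val /= ltn_eqF.
  rewrite big1 ?addn0 1?addnC // => i /andP[im ip]; apply/eqP/(implyP (ut i)).
  by move: im ip (ltn_ord i); rewrite -!val_eqE pen_val /=; lia.
have mE : tail_mon (mdeg u) (u pen) ord_max = u ord_max.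
  rewrite mnmDE !mulmnE !mnm1E eqxx -val_eqE pen_val /=.
  by rewrite (ltn_eqF (ltnSn r)) mul0n mul1n du addKn.
apply/mnmP => i; have [ir|] := ltnP i r.
  by rewrite tail_mon_small //; apply/eqP/(implyP (ut i)).
rewrite leq_eqVlt => /orP[/eqP ir|ri].
  by have -> : i = pen; [apply: val_inj; rewrite pen_val | rewrite tail_mon_pen].
have -> : i = ord_max by apply: val_inj; apply/eqP; rewrite /= eqn_leq ri -ltnS ltn_ord.
by rewrite mE.
Qed.

Lemma tail_mon_lt d a b : (a <= d)%N -> (b <= d)%N -> (a < b)%N ->
  (tail_mon d a < tail_mon d b)%O.
Proof.
move=> ad bd ab; apply/ltmcP; first by rewrite !mdeg_tail_mon.
exists pen; last by rewrite !tail_mon_pen.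
by move=> j; rewrite pen_val => jr; rewrite !tail_mon_small.
Qed.

Lemma tail_mon_lt_nontail u a : (a <= mdeg u)%N -> ~~ is_tail u -> (tail_mon (mdeg u) a < u)%O.
Proof.
move=> au /forallPn [i0]; rewrite negb_imply => hi0.
(* The first variable occurring in [u] decides the comparison. *)
have [i /andP[ir ui] mini] 
  := @arg_minnP _ i0 (fun i : 'I_n => (i < r)%N && (u i != 0%N)) (fun i : 'I_n => val i) hi0.
apply/ltmcP; first by rewrite mdeg_tail_mon.
exists i => [j ji|]; last by rewrite tail_mon_small // lt0n.
have jr := ltn_trans ji ir; rewrite tail_mon_small //; apply/esym/eqP.
by apply: contraTT ji => uj; rewrite -leqNgt mini // jr.
Qed.

Lemma leq_lex_rank u k : (k <= (mdeg u).+1)%N ->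
  (forall a, (a < k)%N -> (tail_mon (mdeg u) a < u)%O) -> (k <= lex_rank u)%N.
Proof.
move=> kd hk; rewrite -(size_iota 0 k) -(size_map (tail_mon (mdeg u))).
apply: uniq_leq_size.
  rewrite map_inj_in_uniq ?iota_uniq // => a b _ _ /(congr1 (fun v : 'X_{1..n} => v pen)).
  by rewrite !tail_mon_pen.
move=> _ /mapP [a + ->]; rewrite mem_iota /= add0n => ak.
rewrite mem_filter mem_monomials hk // mdeg_tail_mon ?eqxx //.
by rewrite -ltnS (leq_trans ak).
Qed.

Lemma lex_rank_nontail u : ~~ is_tail u -> (mdeg u < lex_rank u)%N.
Proof. by move=> ut; apply: leq_lex_rank => // a; rewrite ltnS => /tail_mon_lt_nontail; apply. Qed.

Lemma lex_rank_tail u : is_tail u -> lex_rank u = u pen.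
Proof.
move=> ut; have le_pen := mdeg_ge u pen.
apply/eqP; rewrite eqn_leq andbC leq_lex_rank ?(leq_trans le_pen) //=; last first.
  move=> a au; rewrite [X in (_ < X)%O](is_tailP u ut).
  by apply: tail_mon_lt => //; rewrite ltnW // (leq_trans au).
rewrite -[X in (_ <= X)%N](size_iota 0) -(size_map (tail_mon (mdeg u))).
apply: uniq_leq_size; first by rewrite filter_uniq ?uniq_monomials.
move=> v; rewrite mem_filter mem_monomials => /andP[vu /eqP dv].
have [vt|/tail_mon_lt_nontail h] := boolP (is_tail v).
  apply/mapP; exists (v pen); last by rewrite -dv; apply/is_tailP.
  rewrite mem_iota /= add0n ltnNge; apply: contraTN vu; rewrite leq_eqVlt -leNgt => uv.
  rewrite [v](is_tailP v vt) [X in (X <= _)%O](is_tailP u ut) dv.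
  case/orP: uv => [/eqP -> //|uv]; apply/ltW/tail_mon_lt => //.
  by rewrite -dv mdeg_ge.
have := lt_trans (h (u pen) _) vu; rewrite dv -(is_tailP u ut) ltxx => /(_ le_pen).
by [].
Qed.

End LexTail.

Section SmallDegree.
Variables (K : fieldType) (r s : nat).
Hypotheses (r0 : (0 < r)%N) (s0 : (0 < s)%N) (sr : (s <= r)%N).
Local Notation n := r.+2.
Implicit Types u v w t : 'X_{1..n}.

Definition lex_cut : pred 'X_{1..n} := fun u => (s <= mdeg u)%N && (r < lex_rank u)%N.

Lemma up_lex_cut : up_closed lex_cut.
Proof.
move=> u w /andP[su ru] uw; apply/andP; split.
  exact: leq_trans su (mdeg_lem uw).
exact: leq_trans ru (leq_lex_rank_lem uw).
Qed.

Lemma lex_cut0 : ~~ lex_cut 0%MM.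
Proof. by rewrite /lex_cut mdeg0 leqNgt s0. Qed.

Lemma lex_lex_cut : lex_closed lex_cut.
Proof.
move=> u v duv /andP[su ru] uv; rewrite /lex_cut -duv su /=.
exact: ltn_trans ru (ltn_lex_rank duv uv).
Qed.

Definition cut_gen : 'X_{1..n} := (U_(pen r) *+ r.+1)%MM.

Lemma cut_genE i : cut_gen i = if i == pen r then r.+1 else 0%N.
Proof. by rewrite mulmnE mnm1E eq_sym; case: eqP => _; rewrite ?mul1n ?mul0n. Qed.

Lemma mdeg_cut_gen : mdeg cut_gen = r.+1.
Proof. by rewrite mdegMn mdeg1 mul1n. Qed.

Lemma lem_cut_gen u : (u <= cut_gen)%MM -> is_tail u.
Proof.
move/mnm_lepP => h; apply/forallP => i; apply/implyP => ir; have := h i.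
by rewrite cut_genE -val_eqE pen_val (ltn_eqF ir) leqn0.
Qed.

Lemma lex_cut_gen : lex_cut cut_gen.
Proof.
rewrite /lex_cut mdeg_cut_gen (lex_rank_tail (lem_cut_gen (lepm_refl _))) cut_genE eqxx.
by rewrite ltnSn andbT ltnW.
Qed.

Lemma lex_cut_gen_min t : lex_cut t -> (t <= cut_gen)%MM -> (r < mdeg t)%N.
Proof.
move=> /andP[_ rt] /lem_cut_gen tt; rewrite (lex_rank_tail tt) in rt.
exact: leq_trans rt (mdeg_ge _ _).
Qed.

(** In degree above [r.+1], a tail monomial has rank equal to its exponent of [pen r], so [cut_gen]
    divides it. Any other has a divisor of degree [r.+1] that keeps a variable of index below [r],
    whose rank exceeds its degree. *)
Lemma lex_cut_generated u : lex_cut u ->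
  exists t, [/\ lex_cut t, (mdeg t <= r.+1)%N & (t <= u)%MM].
Proof.
move=> cu; have [du|du] := leqP (mdeg u) r.+1; first by exists u; rewrite lepm_refl.
have [ut|/[dup] unt /forallPn [i]] := boolP (is_tail u).
  exists cut_gen; rewrite lex_cut_gen mdeg_cut_gen; split=> //.
  apply/mnm_lepP => i; rewrite cut_genE; case: eqP => // ->.
  by case/andP: cu => _; rewrite (lex_rank_tail ut).
rewrite negb_imply => /andP[ir ui].
have le_u : (U_(i) <= u)%MM by rewrite lep1mP.
have [|t tu dt] := @divisor_of_degree _ (u - U_(i))%MM r.
  by have := mdegD (u - U_(i)) U_(i); rewrite submK // mdeg1; lia.
exists (t + U_(i))%MM; have dti : mdeg (t + U_(i))%MM = r.+1 by rewrite mdegD mdeg1 dt addn1.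
have nt : ~~ is_tail (t + U_(i))%MM.
  by apply/forallPn; exists i; rewrite negb_imply ir mnmDE mnm1E eqxx addn1.
split; rewrite ?dti //.
  by have := lex_rank_nontail nt; rewrite /lex_cut dti (leqW sr) => /ltnW.
by rewrite -(submK le_u); apply/mnm_lepP => j; rewrite !mnmDE leq_add2r (mnm_lepP tu).
Qed.

Lemma lex_cut_vars : subpred lex_cut (vars_below r.+1).
Proof.
move=> u /andP[_ ru]; have [ut|/forallPn [i]] := boolP (is_tail u); last first.
  by rewrite negb_imply => /andP[ir ui]; apply/existsP; exists i; rewrite ltnW.
rewrite (lex_rank_tail ut) in ru; apply/existsP; exists (pen r).
by rewrite pen_val ltnSn -lt0n (leq_trans _ ru).
Qed.

Local Notation H d := (size (standard_monomials lex_cut d)).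

Lemma size_monomials_ge d : (0 < d)%N -> (r.+1 < size (monomials n d))%N.
Proof.
move=> d0; rewrite size_monomials addnC -bin_sub ?leq_addl // addnK.
by apply: leq_trans (leq_bin2l r.+1 (_ : r.+2 <= _)%N); rewrite ?binSn //; lia.
Qed.

Lemma lex_cut_hilbert d : (s <= d)%N -> H d = r.+1.
Proof.
move=> sd; have d0 : (0 < d)%N by apply: leq_trans sd.
rewrite -[RHS](count_lex_rank (ltnW (size_monomials_ge d0))) /standard_monomials.
apply: (congr1 size); apply: eq_in_filter => u; rewrite mem_monomials => /eqP du.
by rewrite /lex_cut du sd /= -leqNgt.
Qed.

Lemma lex_cut_hilbert_small d : (d < s)%N -> H d = size (monomials n d).
Proof.
move=> ds; congr size; apply/all_filterP/allP => u; rewrite mem_monomials => /eqP du.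
by rewrite /lex_cut du leqNgt ds.
Qed.

(** For s > 1 there are more than [r.+1] monomials of degree s - 1; for s = 1 there is one, and [r]
    is positive. *)
Lemma lex_cut_jump : H s.-1 != r.+1.
Proof.
rewrite lex_cut_hilbert_small ?prednK //; case: (s.-1) => [|d].
  by rewrite size_monomials bin0; lia.
by rewrite gtn_eqF // size_monomials_ge.
Qed.

Lemma lex_cut_cover N : exists B : seq 'X_{1..n},
  (size B <= (r.+1 + \max_(d < s) H d) * N.+1 ^ 1)%N /\
  forall u, ~~ lex_cut u -> (mdeg u <= N)%N -> u \in B.
Proof.
exists (flatten [seq standard_monomials lex_cut d | d <- iota 0 N.+1]); split; last first.
  move=> u nu uN; apply/flatten_mapP; exists (mdeg u); first by rewrite mem_iota.
  by rewrite mem_filter nu mem_monomials eqxx.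
rewrite size_flatten expn1 mulnC -{2}(size_iota 0 N.+1); elim: (iota _ _) => //= d l IHl.
rewrite mulSn leq_add //; have [ds|sd] := ltnP d s; last by rewrite lex_cut_hilbert ?leq_addr.
apply: leq_trans (leq_addl _ _); exact: (leq_bigmax (F := fun d : 'I_s => H d) (Ordinal ds)).
Qed.

Theorem lex_cut_example : exists (I : idealr {mpoly K[n]}) (h : {poly int}),
  [/\ lexsegment_ideal I, regularity I r%:Z, h_polynomial I h & size h = s.+1].
Proof.
pose I := mono_ideal K up_lex_cut lex_cut0.
(* In dimension 1 the coefficients of [h] are the first differences of the Hilbert function, which
   vanish after degree [s]. *)
pose h : {poly int} := \poly_(k < s.+1) delta (fun d => (H d)%:Z) k.
exists I, h; split.
- exact: mono_ideal_lexsegment lex_lex_cut.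
- exact: (mono_regularity _ _ _ lex_lex_cut lex_cut_generated lex_cut_gen mdeg_cut_gen lex_cut_gen_min).
- exists 1%N, (fun d => H d); split.
  + apply: mono_krull_dim lex_cut_cover => //.
    by move=> u /lex_cut_vars; rewrite subn1.
  + exact: mono_hilbert_function.
  + move=> k; rewrite -[RHS]/(conv (fun d => (H d)%:Z) 1 k) conv_delta conv0 coef_poly.
    case: ltnP => // ks; rewrite /delta; case: k ks => // k ks.
    by rewrite !lex_cut_hilbert ?subrr // ltnW.
- apply: size_poly_eq; rewrite /delta -(prednK s0) /= prednK //.
  by rewrite lex_cut_hilbert // subr_eq0 eq_sym eqz_nat lex_cut_jump.
Qed.

End SmallDegree.

(** * The case s > r *)

Section Convolutions.
Implicit Type f : nat -> int.

Definition shift r f i : int := if (r <= i)%N then f (i - r)%N else 0.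

Lemma conv_shift r f d k : conv (shift r f) d k = shift r (conv f d) k.
Proof.
elim: d f k => [|d IHd] f k; first by rewrite conv0 /shift; case: ifP; rewrite ?conv0.
rewrite conv_delta (eq_conv (g := shift r (delta f))) => [|i _].
  by rewrite IHd /shift; case: ifP => //; rewrite conv_delta.
rewrite /delta /shift; case: i => [|i]; first by case: (r) => [|r'] /=; rewrite !subr0.
have [ri|ri] := leqP r i; first by rewrite leqW // subSn.
rewrite subr0; case: ifP => // ri'.
have -> : (i.+1 - r = 0)%N by lia.
by rewrite subr0.
Qed.

Lemma conv_delta0 d k : conv (fun i => (i == 0%N)%:R) d k = ((1 - 'X) ^+ d : {poly int})`_k.
Proof.
by rewrite /conv big_ord_recl /= mul1r subn0 big1 ?addr0 // => i _; rewrite mul0r.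
Qed.

(** The binomials are the coefficients of [1/(1-t)^(d+1)]; by Pascal's rule a difference lowers [d]
    by one. *)
Lemma conv_binomial d k : conv (fun i => ('C(i + d, i))%:Z) d k = 1.
Proof.
elim: d k => [|d IHd] k; first by rewrite conv0 addn0 binn.
rewrite conv_delta -(IHd k); apply: eq_conv => -[|i] _; rewrite /delta ?bin0 ?subr0 //.
rewrite addSn binS [(i + d.+1)%N]addnS -addSn.
by rewrite PoszD addrK.
Qed.

End Convolutions.

Section LargeDegree.
Variables (K : fieldType) (r d : nat).
Hypothesis r0 : (0 < r)%N.
Local Notation n := d.+1.
Implicit Types u v w t : 'X_{1..n}.

Definition x1_mul : pred 'X_{1..n} := fun u => (r <= u ord0)%N && (r < mdeg u)%N.

Lemma up_x1_mul : up_closed x1_mul.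
Proof.
move=> u w /andP[ru du] uw; rewrite /x1_mul (leq_trans ru) ?(mnm_lepP uw) //=.
exact: leq_trans du (mdeg_lem uw).
Qed.

Lemma x1_mul0 : ~~ x1_mul 0%MM.
Proof. by rewrite /x1_mul mdeg0 andbF. Qed.

Lemma lex_x1_mul : lex_closed x1_mul.
Proof.
move=> u v duv /andP[ru du] uv; rewrite /x1_mul -duv du andbT (leq_trans ru) //.
have [i eqi lti] := ltmcP duv uv; have [i0|i0] := posnP i.
  by have -> : ord0 = i; [apply: val_inj | rewrite ltnW].
by rewrite eqi.
Qed.

Definition x1_pow k : 'X_{1..n} := (U_(ord0) *+ k)%MM.

Lemma x1_pow0 k : x1_pow k ord0 = k.
Proof. by rewrite mulmnE mnm1E eqxx mul1n. Qed.

Lemma mdeg_x1_pow k : mdeg (x1_pow k) = k.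
Proof. by rewrite mdegMn mdeg1 mul1n. Qed.

Lemma x1_pow_lem k u : (k <= u ord0)%N -> (x1_pow k <= u)%MM.
Proof.
by move=> ku; apply/mnm_lepP => i; rewrite mulmnE mnm1E; case: eqP => [<-|]; rewrite ?mul1n.
Qed.

Lemma x1_mul_generated u : x1_mul u ->
  exists t, [/\ x1_mul t, (mdeg t <= r.+1)%N & (t <= u)%MM].
Proof.
case/andP => ru du; have le_u := x1_pow_lem ru.
have [|t tu dt] := @divisor_of_degree _ (u - x1_pow r)%MM 1.
  by have := mdegD (u - x1_pow r)%MM (x1_pow r); rewrite submK // mdeg_x1_pow; lia.
have dE : mdeg (t + x1_pow r)%MM = r.+1 by rewrite mdegD dt mdeg_x1_pow.
exists (t + x1_pow r)%MM; split; rewrite ?dE //.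
  by rewrite /x1_mul dE ltnSn andbT mnmDE x1_pow0 leq_addl.
by rewrite -(submK le_u); apply/mnm_lepP => j; rewrite !mnmDE leq_add2r (mnm_lepP tu).
Qed.

Lemma x1_mul_gen : x1_mul (x1_pow r.+1).
Proof. by rewrite /x1_mul x1_pow0 mdeg_x1_pow leqnSn ltnSn. Qed.

Lemma x1_mul_vars : subpred x1_mul (vars_below 1).
Proof. by move=> u /andP[ru _]; apply/existsP; exists ord0; rewrite /= -lt0n (leq_trans r0). Qed.

(** Outside the ideal the first exponent is at most [r]; the other [d] exponents are bounded by
    [N]. *)
Lemma x1_mul_cover N : exists B : seq 'X_{1..n},
  (size B <= r.+1 * N.+1 ^ d)%N /\ forall u, ~~ x1_mul u -> (mdeg u <= N)%N -> u \in B.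
Proof.
pose mon (p : 'I_r.+1 * {ffun 'I_d -> 'I_N.+1}) : 'X_{1..n} :=
  [multinom if unlift ord0 i is Some j then p.2 j : nat else p.1 | i < n].
exists [seq mon p | p <- enum {: 'I_r.+1 * {ffun 'I_d -> 'I_N.+1}}]; split.
  by rewrite size_map -cardE card_prod card_ffun !card_ord.
move=> u nu uN; have u0 : (u ord0 < r.+1)%N.
  move: nu; rewrite negb_and -!ltnNge; case/orP => h; first exact: leqW.
  exact: leq_ltn_trans (mdeg_ge u ord0) h.
have uj (j : 'I_d) : (u (lift ord0 j) < N.+1)%N by rewrite ltnS (leq_trans (mdeg_ge _ _)).
apply/mapP; exists (Ordinal u0, [ffun j => Ordinal (uj j)]); first by rewrite mem_enum.
apply/mnmP => i; rewrite mnmE /=; case: unliftP => [j ->|->] //=.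
by rewrite ffunE.
Qed.

Local Notation H m := (size (standard_monomials x1_mul m)).

Lemma x1_mul_count m : (r < m)%N ->
  size [seq u <- monomials n m | x1_mul u] = size (monomials n (m - r)).
Proof.
move=> rm; rewrite -(size_map (fun v => v + x1_pow r)%MM (monomials n (m - r))).
apply/perm_size/uniq_perm.
- by rewrite filter_uniq ?uniq_monomials.
- by rewrite map_inj_uniq ?uniq_monomials //; apply: addIm.
move=> u; rewrite mem_filter mem_monomials; apply/idP/mapP.
  case/andP => /andP[ru _] /eqP du; exists (u - x1_pow r)%MM; last by rewrite submK ?x1_pow_lem.
  have := mdegD (u - x1_pow r)%MM (x1_pow r).
  by rewrite submK ?x1_pow_lem // mdeg_x1_pow mem_monomials; lia.
case=> v + ->; rewrite mem_monomials /x1_mul mdegD mnmDE mdeg_x1_pow x1_pow0 leq_addl /=; lia.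
Qed.

(** The standard monomials are the non-multiples of the [r]-th power of the first variable, together
    with that power itself, restored by the last summand. *)
Lemma x1_mul_hilbert m :
  (H m)%:Z = ('C(m + d, m))%:Z - shift r (fun i => ('C(i + d, i))%:Z) m
             + shift r (fun i => (i == 0%N)%:R) m.
Proof.
have : (size [seq u <- monomials n m | x1_mul u] + H m)%N = 'C(m + d, m).
  by rewrite -size_monomials !size_filter count_predC.
rewrite /shift; have [rm|mr] := ltnP r m.
  rewrite x1_mul_count // size_monomials (ltnW rm) => <-.
  by rewrite subn_eq0 leqNgt rm /= addr0 PoszD addrAC subrr add0r.
rewrite (_ : [seq u <- _ | _] = [::]); last first.
  apply/eqP; rewrite -size_eq0 size_filter -leqn0 leqNgt -has_count; apply/hasPn => u.
  by rewrite mem_monomials /x1_mul => /eqP ->; rewrite ltnNge mr andbF.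
move=> <-; case: ifP => rm; last by rewrite subr0 addr0.
have -> : m = r by lia.
by rewrite subnn bin0 subrK.
Qed.

Theorem x1_mul_example : (0 < d)%N -> exists (I : idealr {mpoly K[n]}) (h : {poly int}),
  [/\ lexsegment_ideal I, regularity I r%:Z, h_polynomial I h & size h = (r + d).+1].
Proof.
move=> d0; pose I := mono_ideal K up_x1_mul x1_mul0.
pose h : {poly int} := 'X^r * (1 - 'X) ^+ d + \poly_(i < r) 1.
exists I, h; split.
- exact: mono_ideal_lexsegment lex_x1_mul.
- apply: (mono_regularity _ _ _ lex_x1_mul x1_mul_generated x1_mul_gen (mdeg_x1_pow _)).
  by move=> t /andP[].
- exists d, (fun m => H m); split.
  + apply: mono_krull_dim x1_mul_cover => //.
    by move=> u /x1_mul_vars; rewrite subSnn.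
  + exact: mono_hilbert_function.
  + move=> k; rewrite -[RHS]/(conv (fun m => (H m)%:Z) d k).
    rewrite (eq_conv _ (fun m _ => x1_mul_hilbert m)) convD convD convN !conv_shift conv_binomial.
    rewrite /shift conv_binomial conv_delta0 coefD coefXnM coef_poly.
    by rewrite ltnNge; case: leqP => _ /=; rewrite ?subrr ?add0r ?addr0 ?subr0.
(* The first summand has degree [r + d]; the other has degree below [r] and cannot cancel its
   leading term. *)
- have sizeX : size ('X^r * (1 - 'X) ^+ d : {poly int}) = (r + d).+1.
    have -> : 1 - 'X = - ('X - 1%:P) :> {poly int} by rewrite opprB.
    rewrite exprNn mulrCA size_Msign mulrC size_mulXn ?size_exp_XsubC ?addnS //.
    by rewrite expf_neq0 ?polyXsubC_eq0.
  by rewrite size_polyDl sizeX // ltnS (leq_trans (size_poly _ _)) ?leq_addr.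
Qed.

End LargeDegree.

Theorem theorem0p1 (K : fieldType) (r s : nat) (hr : (1 <= r)%N)
    (hs : (1 <= s)%N) :
  exists (n : nat) (I : idealr {mpoly K[n]}) (h : {poly int}),
    [/\ (0 < n <= maxn r s + 2)%N,
        lexsegment_ideal I,
        regularity I r%:Z,
        h_polynomial I h
      & size h = s.+1].
Proof.
(* The number of variables is r + 2 in the first case. In the second, d = s - r gives s - r + 1
   variables and degree r + d = s. *)
have [sr|rs] := leqP s r.
  have [I [h [lexI regI hI sh]]] := lex_cut_example K hr hs sr.
  by exists r.+2, I, h; split=> //; lia.
have [|I [h [lexI regI hI sh]]] := @x1_mul_example K r (s - r) hr; first by rewrite subn_gt0.
exists (s - r).+1, I, h; split=> //; first by lia.
by rewrite sh subnKC // ltnW.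
Qed.
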